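(* Let $G_0,G_1,G_\infty$ be the normalized solutions of the formal KZ equation $\frac{dG}{dz}=\left(\frac{X}{z}+\frac{Y}{1-z}\right)G$, and let $\pi(f)$ be the operators attached to linear fractional transformations $f$ (all defined in the context). Then $$\pi(1-z)(G_0)=G_1,\qquad \pi\left(\tfrac1z\right)(G_0)=G_\infty,$$ and, for $z\in\mathbf{H}_{\pm}$ (upper signs for $\mathbf{H}_+$, lower signs for $\mathbf{H}_-$), $$\pi\left(\tfrac{z}{z-1}\right)(G_0)=G_0\cdot\exp(\mp X\pi i),$$ $$\pi\left(\tfrac{1}{1-z}\right)(G_0)=G_1\cdot\exp(\mp Y\pi i),$$ $$\pi\left(\tfrac{z-1}{z}\right)(G_0)=G_\infty\cdot\exp(\pm(-X+Y)\pi i).$$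
   Context: Shuffle algebra. Let $\mathfrak h=\mathbb C\langle x,y\rangle$ be the non-commutative polynomial algebra, with shuffle product $\sqcup\!\sqcup$ defined bilinearly by $1\sqcup\!\sqcup w=w\sqcup\!\sqcup 1=w$ and $l_1w_1\sqcup\!\sqcup l_2w_2=l_1(w_1\sqcup\!\sqcup l_2w_2)+l_2(l_1w_1\sqcup\!\sqcup w_2)$ for letters $l_1,l_2\in\{x,y\}$ and words $w,w_1,w_2$. Put $\mathfrak h^1=\mathbb C1\oplus\mathfrak hy$. With the shuffle product, $\mathfrak h=\mathfrak h^1[x]$ (polynomial algebra in $x$ over $\mathfrak h^1$). Multiple polylogarithms. Let $D=\mathbb C\setminus((-\infty,0]\cup[1,\infty))$. For $w=x^{k_1-1}y\cdots x^{k_m-1}y\in\mathfrak h^1$, $\mathrm{Li}(w;z)=\sum_{n_1>\dots>n_m>0}\frac{z^{n_1}}{n_1^{k_1}\cdots n_m^{k_m}}$ for $|z|<1$, analytically continued to $D$ (by iterated integrals from $0$); $\mathrm{Li}(1;z)=1$; $\mathrm{Li}(x;z)=\log z$ (principal branch). $\mathrm{Li}(\bullet;z)$ is extended to all of $\mathfrak h$ as the unique linear map which is a homomorphism for the shuffle product. Formal solutions. Let $\mathfrak H=\mathbb C\langle\langle X,Y\rangle\rangle$ be the algebra of non-commutative formal power series. For a word $W$ in $X,Y$, $w$ denotes the word in $x,y$ obtained by replacing $X\mapsto x$, $Y\mapsto y$. Limits and differentiation in $\mathfrak H$ are coefficientwise, and $a^{A}=\exp(A\log a)$ with principal logarithm.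 The function $$G_0(z)=G_0(X,Y;z)=\sum_W\mathrm{Li}(w;z)\,W,\qquad z\in D,$$ is the unique $\mathfrak H$-valued solution of $\frac{dG}{dz}=\left(\frac Xz+\frac Y{1-z}\right)G$ on $D$ with $G_0(z)z^{-X}\to1$ as $z\to0$. $G_1$ denotes the unique solution on $D$ with $G_1(z)(1-z)^{Y}\to1$ as $z\to1$, and $G_\infty$ the unique solution on $\mathbb C\setminus(-\infty,1]$ with $G_\infty(z)(1/z)^{X-Y}\to1$ as $z\to\infty$. $\mathbf H_+$ and $\mathbf H_-$ are the open upper and lower half planes. The operators $\pi(f)$. Let $f$ be one of the six linear fractional transformations $z,\ 1-z,\ \frac1z,\ \frac z{z-1},\ \frac1{1-z},\ \frac{z-1}z$. Define a continuous algebra homomorphism $f_*:\mathfrak H\to\mathfrak H$ by: for $z$: $(X,Y)\mapsto(X,Y)$; for $1-z$: $(X,Y)\mapsto(-Y,-X)$; for $\frac1z$: $(X,Y)\mapsto(-X+Y,Y)$; for $\frac z{z-1}$: $(X,Y)\mapsto(X,X-Y)$; for $\frac1{1-z}$: $(X,Y)\mapsto(-Y,X-Y)$; for $\frac{z-1}z$: $(X,Y)\mapsto(-X+Y,-X)$. For an $\mathfrak H$-valued function $F(X,Y;z)=\sum_W\ell(w;z)W$, set $$\pi(f)F(X,Y;z)=F(f_*(X),f_*(Y);f^{-1}(z))=\sum_W\ell(w;f^{-1}(z))\,f_*(W),$$ where $f^{-1}$ is the inverse map of $f$. *)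

(* Defs.v *)
From HB Require Import structures.
From mathcomp Require Import all_boot all_order all_algebra.
From mathcomp Require Import all_classical all_reals all_analysis.
From mathcomp Require Import complex ring.

Set Implicit Arguments.
Unset Strict Implicit.
Unset Printing Implicit Defensive.

Import Order.TTheory GRing.Theory Num.Theory numFieldNormedType.Exports.

Local Open Scope classical_set_scope.
Local Open Scope ring_scope.
Local Open Scope complex_scope.

(* The library gives every numFieldType its norm topology, but does not declare
   it on [complex R]. *)
HB.instance Definition _ (R : realType) :=
  GRing.ComAlgebra.copy R[i] (R[i] : numFieldType)^o.
HB.instance Definition _ (R : realType) :=
  Vector.copy R[i] (R[i] : numFieldType)^o.
HB.instance Definition _ (R : realType) :=
  NormedModule.copy R[i] (R[i] : numFieldType)^o.
HB.instance Definition _ (R : realType) := Num.ClosedField.on R[i].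

(* lx stands for both x and X, ly for both y and Y, so that w and W are the
   same object. *)
Variant letter := lx | ly.

Definition letter_to_bool l := if l is lx then false else true.
Definition bool_to_letter (b : bool) := if b then ly else lx.
Lemma letter_to_boolK : cancel letter_to_bool bool_to_letter.
Proof. by case. Qed.
HB.instance Definition _ := Finite.copy letter (can_type letter_to_boolK).

Notation word := (seq letter).

(* The shuffle product of two words, as the list of its terms with
   multiplicity. *)
Fixpoint shuffle (u : word) : word -> seq word :=
  match u with
  | [::] => fun v => [:: v]
  | l1 :: u' => fix shuffle_u v :=
      match v with
      | [::] => [:: u]
      | l2 :: v' => map (cons l1) (shuffle u' v) ++ map (cons l2) (shuffle_u v')
      end
  end.

Section FormalSeries.
Variable K : comNzRingType.
Implicit Types (F G H A B : word -> K) (w v : word).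

(* K<<X,Y>>: F w is the coefficient of the word w. *)
Definition fps : Type := word -> K.

HB.instance Definition _ := GRing.Lmodule.copy fps (word -> K^o).

Definition fone : fps := fun w => (w == [::])%:R.

Definition fmul (F G : fps) : fps :=
  fun w => \sum_(i < (size w).+1) F (take i w) * G (drop i w).

Lemma fmulA : associative fmul.
Proof.
move=> F G H; apply/funext => w; rewrite /fmul; set n := size w.
transitivity (\sum_(i < n.+1) \sum_(j < n.+1 | (i <= j)%N)
   F (take i w) * (G (drop i (take j w)) * H (drop j w))).
  apply: eq_bigr => i _; rewrite big_distrr /= size_drop -/n.
  have lein : (i <= n)%N by rewrite -ltnS.
  rewrite -(big_mkord xpredT (fun k =>
    F (take i w) * (G (take k (drop i w)) * H (drop k (drop i w))))).
  rewrite -(big_mkord (fun j => (i <= j)%N) (fun j =>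
    F (take i w) * (G (drop i (take j w)) * H (drop j w)))).
  rewrite [RHS](big_cat_nat _ (n := i)) //=; last exact: ltnW.
  rewrite [X in X + _]big_nat_cond [X in X + _]big_pred0 ?add0r; last first.
    by move=> j; case: ltnP.
  have -> : index_iota i n.+1 = index_iota (0 + i) n.+1 by rewrite add0n.
  rewrite [RHS]big_addn subSn //.
  rewrite big_mkord [RHS]big_mkord; apply: eq_big => [k|k _].
    by rewrite leq_addl.
  by rewrite take_drop drop_drop.
rewrite (exchange_big_dep xpredT) //=; apply: eq_bigr => j _.
have lejn : (j <= n)%N by rewrite -ltnS.
rewrite big_distrl /= size_takel //.
rewrite (big_ord_widen n.+1 (fun i =>
  F (take i (take j w)) * G (drop i (take j w)) * H (drop j w))) //.
by apply: eq_big => [i|i /= leij]; rewrite ?ltnS // take_takel // mulrA.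
Qed.

Lemma fmul1l : left_id fone fmul.
Proof.
move=> F; apply/funext => w; rewrite /fmul big_ord_recl /= take0 drop0.
rewrite {1}/fone eqxx mul1r big1 ?addr0 // => i _.
rewrite /fone -size_eq0 size_takel; last by rewrite /= /bump add1n; exact: ltn_ord.
by rewrite mul0r.
Qed.

Lemma fmul1r : right_id fone fmul.
Proof.
move=> F; apply/funext => w; rewrite /fmul big_ord_recr /= take_size drop_size.
rewrite {2}/fone eqxx mulr1 big1 ?add0r // => i _.
by rewrite /fone -size_eq0 size_drop subn_eq0 leqNgt ltn_ord mulr0.
Qed.

Lemma fmulDl : left_distributive fmul +%R.
Proof.
move=> F G H; apply/funext => w; rewrite /fmul.
by rewrite [RHS]/GRing.add /= -big_split; apply: eq_bigr => i _; rewrite /= -mulrDl.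
Qed.

Lemma fmulDr : right_distributive fmul +%R.
Proof.
move=> F G H; apply/funext => w; rewrite /fmul.
by rewrite [RHS]/GRing.add /= -big_split; apply: eq_bigr => i _; rewrite /= -mulrDr.
Qed.

Lemma fone_neq0 : fone != 0.
Proof.
by apply/eqP => /(congr1 (fun F => F [::])) /eqP; rewrite /fone eqxx oner_eq0.
Qed.

HB.instance Definition _ := GRing.Zmodule_isNzRing.Build fps
  fmulA fmul1l fmul1r fmulDl fmulDr fone_neq0.

Lemma fscaleAl (c : K) (F G : fps) : c *: (F * G) = c *: F * G.
Proof.
apply/funext => w; transitivity (c * fmul F G w) => //; rewrite /fmul mulr_sumr.
by apply: eq_bigr => i _; rewrite mulrA.
Qed.

HB.instance Definition _ := GRing.Lmodule_isLalgebra.Build K fps fscaleAl.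

Lemma fscaleAr (c : K) (F G : fps) : c *: (F * G) = F * (c *: G).
Proof.
apply/funext => w; transitivity (c * fmul F G w) => //; rewrite /fmul mulr_sumr.
by apply: eq_bigr => i _; rewrite mulrCA.
Qed.

HB.instance Definition _ := GRing.Lalgebra_isAlgebra.Build K fps fscaleAr.

Definition fX : fps := fun w => (w == [:: lx])%:R.
Definition fY : fps := fun w => (w == [:: ly])%:R.

Definition fword (A B : fps) (w : word) : fps :=
  \prod_(l <- w) (if l is lx then A else B).

(* The continuous algebra homomorphism X |-> A, Y |-> B applied to F, for A and
   B with zero constant term: the image of a word longer than v then does not
   contribute to the coefficient of v, so the sum over all words truncates. *)
Definition fsubst (A B F : fps) : fps := fun v =>
  \sum_(n < (size v).+1) \sum_(w : n.-tuple letter) F w * fword A B w v.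

End FormalSeries.

(* exp A for A with zero constant term: A ^+ n has no word shorter than n. *)
Definition fexp (K : fieldType) (A : fps K) : fps K :=
  fun w => \sum_(n < (size w).+1) (A ^+ n) w / n`!%:R.

Section LinearFractional.

Variant lft := Lz | L1mz | Linvz | Lz_zm1 | Linv1mz | Lzm1_z.

Definition lft_fun (K : fieldType) (f : lft) (z : K) : K :=
  match f with
  | Lz => z
  | L1mz => 1 - z
  | Linvz => 1 / z
  | Lz_zm1 => z / (z - 1)
  | Linv1mz => 1 / (1 - z)
  | Lzm1_z => (z - 1) / z
  end.

Definition lft_inv (f : lft) : lft :=
  match f with
  | Linv1mz => Lzm1_z
  | Lzm1_z => Linv1mz
  | _ => f
  end.

Lemma lft_invK : involutive lft_inv.
Proof. by case. Qed.

Lemma lft_funK (K : fieldType) (f : lft) (z : K) : z != 0 -> z != 1 ->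
  lft_fun f (lft_fun (lft_inv f) z) = z.
Proof.
move=> z0 z1.
have z1' : z - 1 != 0 by rewrite subr_eq0.
have z1'' : 1 - z != 0 by rewrite subr_eq0 eq_sym.
have z2 : z - (z - 1) != 0 by rewrite subKr oner_eq0.
by case: f => //=; field; rewrite ?mulN1r ?z0 ?z1' ?z1'' ?z2 ?oner_eq0.
Qed.

Definition lft_X (K : comNzRingType) (f : lft) : fps K :=
  match f with
  | Lz => fX K
  | L1mz => - fY K
  | Linvz => - fX K + fY K
  | Lz_zm1 => fX K
  | Linv1mz => - fY K
  | Lzm1_z => - fX K + fY K
  end.

Definition lft_Y (K : comNzRingType) (f : lft) : fps K :=
  match f with
  | Lz => fY K
  | L1mz => - fX K
  | Linvz => fY K
  | Lz_zm1 => fX K - fY K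
  | Linv1mz => fX K - fY K
  | Lzm1_z => - fX K
  end.

(* The operator pi(f); named so to avoid the number [pi]. *)
Definition lft_op (K : fieldType) (f : lft) (F : K -> fps K) : K -> fps K :=
  fun z => fsubst (lft_X K f) (lft_Y K f) (F (lft_fun (lft_inv f) z)).

End LinearFractional.

Section ComplexAnalysis.
Variable R : realType.
Local Notation C := R[i].

(* The norm of R[i] takes values in R[i]. *)
Definition cabs (z : C) : R := complex.Re `|z|.

Definition carg (z : C) : R :=
  if 0 <= complex.Im z then acos (complex.Re z / cabs z) else - acos (complex.Re z / cabs z).

(* Principal branch, argument in ]-pi, pi]. *)
Definition clog (z : C) : C := ln (cabs z) +i* carg z.

Definition fpow (a : C) (A : fps C) : fps C := fexp (clog a *: A).

Definition domD : set C :=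
  ~` [set z | complex.Im z = 0 /\ (complex.Re z <= 0 \/ 1 <= complex.Re z)].

Definition domDinf : set C := ~` [set z | complex.Im z = 0 /\ complex.Re z <= 1].

Definition cinfty_nbhs : set_system C :=
  filter_from [set: R] (fun M => [set z | M < cabs z]).

Definition analytic_on (D : set C) (f : C -> C) : Prop :=
  forall a, D a -> exists c : nat -> C,
    \forall z \near a, series (fun n => c n * (z - a) ^+ n) @ \oo --> f z.

End ComplexAnalysis.

Section Polylogarithms.
Variable R : realType.
Local Notation C := R[i].

(* x^(k_1 - 1) y ... x^(k_m - 1) y *)
Definition index_word (ks : seq nat) : word :=
  flatten [seq rcons (nseq k.-1 lx) ly | k <- ks].

(* Sum over N > n_1 > ... > n_m > 0 of 1 / (n_1^k_1 ... n_m^k_m). *)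
Fixpoint mzsum (ks : seq nat) (N : nat) : C :=
  if ks is k :: ks' then \sum_(1 <= n < N) n%:R ^- k * mzsum ks' n else 1.

(* Partial sum n_1 < N of the series defining Li(x^(k_1 - 1) y ...; z). *)
Definition polylog_sum (ks : seq nat) (z : C) (N : nat) : C :=
  if ks is k :: ks' then
    \sum_(1 <= n < N) z ^+ n / n%:R ^+ k * mzsum ks' n
  else 1.

(* Li w z is Li(w; z); the values on words determine the linear extension to
   C<x,y>.  The first two fields define Li on h^1 by series and analytic
   continuation; these, Li(x; z) and the shuffle relations determine Li on D. *)
Record polylogarithms (Li : word -> C -> C) : Prop := Polylogarithms {
  Li_series : forall ks, all (leq 1) ks -> forall z, domD z -> `|z| < 1 ->
    polylog_sum ks z @ \oo --> Li (index_word ks) z;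
  Li_analytic : forall ks, all (leq 1) ks ->
    analytic_on (@domD R) (Li (index_word ks));
  Li_x : forall z, domD z -> Li [:: lx] z = clog z;
  Li_shuffle : forall u v z, domD z ->
    \sum_(w <- shuffle u v) Li w z = Li u z * Li v z
}.

Definition G0_series (Li : word -> C -> C) : C -> fps C := fun z w => Li w z.

End Polylogarithms.

Section KZ.
Variable R : realType.
Local Notation C := R[i].
Local Notation X := (fX C).
Local Notation Y := (fY C).

Definition KZ_solution (D : set C) (G : C -> fps C) : Prop :=
  forall z, D z -> forall w, is_derive z 1 (fun t => G t w)
    (((z^-1 *: X + (1 - z)^-1 *: Y) * G z) w).

Definition fps_cvg1 (S : set_system C) (F : C -> fps C) : Prop :=
  forall w, F z w @[z --> S] --> (1 : fps C) w.

Definition is_G1 (G : C -> fps C) : Prop :=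
  KZ_solution (@domD R) G /\
  fps_cvg1 (within (@domD R) (nbhs (1 : C)))
    (fun z => G z * fpow (1 - z) Y).

Definition is_Ginf (G : C -> fps C) : Prop :=
  KZ_solution (@domDinf R) G /\
  fps_cvg1 (within (@domDinf R) (@cinfty_nbhs R))
    (fun z => G z * fpow (1 / z) (X - Y)).

End KZ.

(* Main.v *)
Require Import Defs.
From mathcomp Require Import all_boot all_order all_algebra.
From mathcomp Require Import all_classical all_reals all_analysis.
From mathcomp Require Import complex ring lra.

(* G_0 solves the KZ equation on the disc by termwise differentiation of the
   series, hence on D by the identity theorem, D being star-shaped at 1/2; the
   shuffle relations with x carry this over from h^1 to all words, through
     x sh v x^k = sum_(v' in xins v) v' x^k + (k + 1) v x^(k+1),
   and the same relations show that the coefficient of a nonempty word v x^k in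
   G_0(z) z^(-X) tends to 0, by induction on k.  Each pi(f)(G_0) then solves the KZ equation
   again, and f_* is multiplicative and maps exp(c X) to exp(c f_*(X)), which
   gives its behaviour at the point f(0).  Finally, if two solutions G, G' agree
   in length < n then their coefficients of length n differ by a constant, and
   this constant is a coefficient of (G - G') P for every P with constant
   term 1; taking P inverse to the common asymptotic behaviour and letting z
   tend to the singular point along a ray, the constant is 0. *)

Set Implicit Arguments.
Unset Strict Implicit.
Unset Printing Implicit Defensive.

Import Order.TTheory GRing.Theory Num.Theory numFieldNormedType.Exports.
Local Open Scope classical_set_scope.
Local Open Scope ring_scope.
Local Open Scope complex_scope.

(** * Modulus, limits and complex derivatives *)

(** The exponential factors come only from the branch of the logarithm. Let a be the local parameter
    z, 1 - z or 1/z at f(0). For 1 - z and 1/z one has f^{-1}(z) = a, and no factor appears. For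
    each of the three half-plane maps f^{-1}(z) = a / (a - 1) = (- a) / (1 - a), so log f^{-1}(z) -
    log a tends to - pi i or + pi i according to the sign of Im a; one limit along a ray thus serves
    all three formulas, and multiplying it by f_*(X) gives the exponent. Working along a ray is
    enough because the comparison of two solutions needs their asymptotics along one proper filter
    only, and it fixes the sign of Im a once and for all. Connectedness enters only through
    segments: D, the domain of G_infinity and the half planes are star-shaped, so constancy of a
    function with zero derivative reduces to the real mean value theorem, and the identity theorem
    to a supremum on [0, 1]. *)

Section ComplexModulus.
Variable R : realType.
Implicit Types z w a : R[i].

Lemma cabsE z : cabs z = Num.sqrt (complex.Re z ^+ 2 + complex.Im z ^+ 2).
Proof. by case: z. Qed.

Lemma normE z : `|z| = (cabs z)%:C.
Proof. by case: z. Qed.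

Lemma cabs_ge0 z : 0 <= cabs z.
Proof. by rewrite cabsE sqrtr_ge0. Qed.

Lemma cabsM z w : cabs (z * w) = cabs z * cabs w.
Proof. by apply: complexI; rewrite rmorphM -!normE normrM. Qed.

Lemma cabs0 : cabs (0 : R[i]) = 0.
Proof. by apply: complexI; rewrite -normE normr0. Qed.

Lemma cabs1 : cabs (1 : R[i]) = 1.
Proof. by apply: complexI; rewrite -normE normr1. Qed.

Lemma cabsX z n : cabs (z ^+ n) = cabs z ^+ n.
Proof. by elim: n => [|n IH]; rewrite ?expr0 ?cabs1 // !exprS cabsM IH. Qed.

Lemma cabsV z : cabs z^-1 = (cabs z)^-1.
Proof. by apply: complexI; rewrite -normE normfV normE fmorphV. Qed.

Lemma cabsN z : cabs (- z) = cabs z.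
Proof. by apply: complexI; rewrite -!normE normrN. Qed.

Lemma cabsB z w : cabs (z - w) = cabs (w - z).
Proof. by rewrite -cabsN opprB. Qed.

Lemma cabsD z w : cabs (z + w) <= cabs z + cabs w.
Proof. by rewrite -lecR rmorphD -!normE ler_normD. Qed.

Lemma cabs_eq0 z : (cabs z == 0) = (z == 0).
Proof. by rewrite -(inj_eq (@complexI R)) -normE normr_eq0. Qed.

Lemma cabs_gt0 z : (0 < cabs z) = (z != 0).
Proof. by rewrite lt_def cabs_ge0 andbT cabs_eq0. Qed.

Lemma cabs_real (x : R) : cabs x%:C = `|x|.
Proof. by rewrite cabsE /= expr0n addr0 sqrtr_sqr. Qed.

Lemma cabs_nat n : cabs (n%:R : R[i]) = n%:R.
Proof. by rewrite -(rmorph_nat (real_complex R)) cabs_real ger0_norm. Qed.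

Lemma cabs_sum I (r : seq I) (F : I -> R[i]) :
  cabs (\sum_(i <- r) F i) <= \sum_(i <- r) cabs (F i).
Proof.
elim/big_ind2 : _ => [|x1 y1 x2 y2 h1 h2|//]; first by rewrite cabs0.
by apply: (le_trans (cabsD _ _)); apply: lerD.
Qed.

Lemma Re_le_cabs z : `|complex.Re z| <= cabs z.
Proof.
by rewrite cabsE -sqrtr_sqr ler_wsqrtr // lerDl sqr_ge0.
Qed.

Lemma Im_le_cabs z : `|complex.Im z| <= cabs z.
Proof.
by rewrite cabsE -sqrtr_sqr ler_wsqrtr // lerDr sqr_ge0.
Qed.

Lemma cabs_le z : cabs z <= `|complex.Re z| + `|complex.Im z|.
Proof.
rewrite {1}(complexE z) (le_trans (cabsD _ _)) // cabsM !cabs_real.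
by rewrite [cabs _](_ : _ = 1) ?mul1r // cabsE /= expr0n expr1n add0r sqrtr1.
Qed.

Lemma ReD z w : complex.Re (z + w) = complex.Re z + complex.Re w.
Proof. by case: z; case: w. Qed.
Lemma ImD z w : complex.Im (z + w) = complex.Im z + complex.Im w.
Proof. by case: z; case: w. Qed.
Lemma ReN z : complex.Re (- z) = - complex.Re z.
Proof. by case: z. Qed.
Lemma ImN z : complex.Im (- z) = - complex.Im z.
Proof. by case: z. Qed.

Section Limits.
Context (T : Type) (F : set_system T) {FF : Filter F}.

(** A positive element of [R[i]] is a positive real number, so the complex-valued radii of the norm
    topology can be traded for real ones; all estimates below are made in [R]. *)
Lemma cvg_cabsP (f : T -> R[i]) (l : R[i]) :
  f @ F --> l <-> forall e : R, 0 < e -> \forall x \near F, cabs (f x - l) < e.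
Proof.
split=> [/cvgrPdist_lt h e e0|h].
  have e0' : 0 < e%:C :> R[i] by rewrite ltcR.
  have := h _ e0'; apply: filterS => x.
  by rewrite normE ltcR cabsB.
apply/cvgrPdist_lt => -[e e'] e0.
have /andP[/eqP /= e'0 e0'] : (e' == 0) && (0 < e) by move: e0; rewrite ltcE.
have := h _ e0'; apply: filterS => x.
by rewrite e'0 complexr0 normE ltcR cabsB.
Qed.

Lemma cvg_cst_cabs (f : T -> R[i]) (l : R[i]) :
  (\forall x \near F, f x = l) -> f @ F --> l.
Proof.
move=> h; apply/cvg_cabsP => e e0; apply: filterS h => x ->.
by rewrite subrr cabs0.
Qed.

Lemma cvg_near_eq (f g : T -> R[i]) (l : R[i]) :
  (\forall x \near F, f x = g x) -> f @ F --> l -> g @ F --> l.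
Proof.
move=> fg /cvg_cabsP h; apply/cvg_cabsP => e e0.
by apply: filterS2 fg (h e e0) => x ->.
Qed.

End Limits.

Lemma nbhs_cabsP a (P : set R[i]) :
  nbhs a P <-> exists2 d : R, 0 < d & forall z, cabs (z - a) < d -> P z.
Proof.
split=> [/nbhs_ballP[e /= e0 h]|[d d0 h]].
  have /andP[/eqP /= e'0 e0'] : (complex.Im e == 0) && (0 < complex.Re e).
    by move: e0; rewrite ltcE.
  exists (complex.Re e) => // z hz; apply: h.
  rewrite -ball_normE /ball_ /= normE cabsB ltcE /=.
  by rewrite e'0 eqxx hz.
apply/nbhs_ballP; exists d%:C => /=; first by rewrite ltcR.
by move=> z; rewrite -ball_normE /ball_ /= normE ltcR cabsB => /h.
Qed.

Lemma hausdorff_complex : hausdorff_space R[i].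
Proof. exact: (@norm_hausdorff _ R[i]). Qed.

Lemma cvg_lim_complex T (F : set_system T) {FF : ProperFilter F}
  (f : T -> R[i]) (l : R[i]) : f @ F --> l -> lim (f @ F) = l.
Proof. exact: (cvg_lim hausdorff_complex). Qed.

Lemma cvg_unique_complex T (F : set_system T) {FF : ProperFilter F}
  (f : T -> R[i]) (l l' : R[i]) : f @ F --> l -> f @ F --> l' -> l = l'.
Proof. by move=> /cvg_lim_complex <- /cvg_lim_complex <-. Qed.

(** The derivative as a first-order approximation: nothing is divided by h, so h = 0 needs no
    exception and every rule of calculus becomes an estimate of a remainder. *)
Definition cderiv (f : R[i] -> R[i]) (z l : R[i]) :=
  forall e : R, 0 < e -> exists2 d : R, 0 < d & forall h, cabs h < d ->
    cabs (f (z + h) - f z - h * l) <= e * cabs h.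

Lemma is_derive_cderivP (f : R[i] -> R[i]) z l :
  is_derive z 1 f l <-> cderiv f z l.
Proof.
have E : is_derive z 1 f l <-> (fun h : R[i] => h^-1 * (f (z + h) - f z)) @ 0^' --> l.
  have -> : (fun h : R[i] => h^-1 * (f (z + h) - f z)) =
    (fun h : R[i] => h^-1 *: (f (h *: (1:R[i]) + z) - f z)).
    by apply/funext => h; rewrite /GRing.scale /= mulr1 [h + z]addrC.
  split=> [[df vf]|h]; first by rewrite -vf.
  have df : derivable f z 1 by apply/cvg_ex; exists l.
  by split=> //; exact: (cvg_lim_complex h).
rewrite E; split => [/cvg_cabsP h e e0|h].
  have := h _ e0; rewrite /dnbhs /within /= => /nbhs_cabsP[d d0 hd].
  exists d => // k; have [->|k0] := eqVneq k 0.
    by rewrite addr0 subrr mul0r subrr cabs0 mulr0.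
  move=> kd; have := hd k; rewrite subr0 => /(_ kd k0) /ltW.
  have k0' : 0 < cabs k by rewrite cabs_gt0.
  move=> /(ler_wpM2r (ltW k0')); rewrite -cabsM.
  congr (cabs _ <= _); by field.
apply/cvg_cabsP => e e0.
have e20 : 0 < e / 2 by lra.
have [d d0 hd] := h _ e20.
apply/nbhs_cabsP; exists d => // k; rewrite subr0 => kd k0.
have k0' : 0 < cabs k by rewrite cabs_gt0.
have h1 := hd _ kd.
have -> : k^-1 * (f (z + k) - f z) - l = (f (z + k) - f z - k * l) / k by field.
rewrite cabsM cabsV ltr_pdivrMr //; apply: le_lt_trans h1 _.
by rewrite ltr_pM2r //; lra.
Qed.

End ComplexModulus.

(** * Rules of differentiation, and functions with zero derivative *)

Section ComplexDerivative.
Variable R : realType.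
Implicit Types (f g : R[i] -> R[i]) (z w l : R[i]).

Lemma cderiv_ext f g z l : (\forall w \near z, f w = g w) ->
  cderiv f z l -> cderiv g z l.
Proof.
move=> /nbhs_cabsP[d d0 fg] df e e0; have [d' d'0 h] := df e e0.
exists (Num.min d d') => [|k]; first by rewrite lt_min d0 d'0.
rewrite lt_min => /andP[kd kd']; rewrite -!fg ?subrr ?cabs0 //; first exact: h.
by rewrite addrC addrA addNr add0r.
Qed.

Lemma cderivD f g z l m : cderiv f z l -> cderiv g z m ->
  cderiv (fun w => f w + g w) z (l + m).
Proof.
move=> df dg e e0; have e20 : 0 < e / 2 by lra.
have [d d0 hd] := df _ e20; have [d' d'0 hd'] := dg _ e20.
exists (Num.min d d') => [|h]; first by rewrite lt_min d0 d'0.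
rewrite lt_min => /andP[/hd hf /hd' hg].
have -> : f (z + h) + g (z + h) - (f z + g z) - h * (l + m) =
  (f (z + h) - f z - h * l) + (g (z + h) - g z - h * m) by ring.
by apply: le_trans (cabsD _ _) _; lra.
Qed.

Lemma cderiv_lip f z l : cderiv f z l -> exists2 d : R, 0 < d &
  forall h, cabs h < d -> cabs (f (z + h) - f z) <= (cabs l + 1) * cabs h.
Proof.
move=> df; have [d d0 hd] := df 1 ltr01; exists d => // h /hd hh.
have -> : f (z + h) - f z = (f (z + h) - f z - h * l) + h * l by rewrite subrK.
apply: le_trans (cabsD _ _) _; rewrite cabsM mulrDl addrC [_ * cabs l]mulrC.
by rewrite lerD2l.
Qed.

Lemma cderivM f g z l m : cderiv f z l -> cderiv g z m ->
  cderiv (fun w => f w * g w) z (l * g z + f z * m).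
Proof.
move=> df dg e e0.
have pos x : 0 < cabs x + 1 by rewrite ltr_wpDl ?cabs_ge0.
have e1 : 0 < e / 3 / (cabs (g z) + 1) by rewrite !divr_gt0 ?pos.
have e2 : 0 < e / 3 / (cabs (f z) + 1) by rewrite !divr_gt0 ?pos.
have e3 : 0 < e / 3 / ((cabs l + 1) * (cabs m + 1)).
  by rewrite !divr_gt0 ?mulr_gt0 ?pos.
have [d1 d10 h1] := df _ e1; have [d2 d20 h2] := dg _ e2.
have [d3 d30 h3] := cderiv_lip df; have [d4 d40 h4] := cderiv_lip dg.
exists (Num.min (Num.min d1 d2) (Num.min (Num.min d3 d4)
   (e / 3 / ((cabs l + 1) * (cabs m + 1))))) => [|h].
  by rewrite !lt_min d10 d20 d30 d40.
rewrite !lt_min => /andP[/andP[/h1 {}h1 /h2 {}h2] /andP[/andP[/h3 {}h3 /h4 {}h4] h5]].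
(* Two first-order remainders and one second-order term, each given a third of e. In the last one
   both increments are Lipschitz, and one of the two factors |h| is absorbed by the fourth
   radius. *)
have -> : f (z + h) * g (z + h) - f z * g z - h * (l * g z + f z * m) =
  (f (z + h) - f z - h * l) * g z + (g (z + h) - g z - h * m) * f z
  + (f (z + h) - f z) * (g (z + h) - g z) by ring.
have -> : e * cabs h = e / 3 / (cabs (g z) + 1) * cabs h * (cabs (g z) + 1)
  + e / 3 / (cabs (f z) + 1) * cabs h * (cabs (f z) + 1)
  + (e / 3 / ((cabs l + 1) * (cabs m + 1))) * ((cabs l + 1) * (cabs m + 1)) * cabs h.
  by field; rewrite !lt0r_neq0 ?pos.
apply: le_trans (cabsD _ _) _; apply: lerD.
  apply: le_trans (cabsD _ _) _; rewrite !cabsM.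
  by apply: lerD; apply: ler_pM; rewrite ?cabs_ge0 // lerDl.
rewrite cabsM; apply: le_trans (ler_pM (cabs_ge0 _) (cabs_ge0 _) h3 h4) _.
set A := e / 3 / _ in h5 *; set B := (cabs l + 1) * (cabs m + 1).
have -> : (cabs l + 1) * cabs h * ((cabs m + 1) * cabs h) = cabs h * (B * cabs h).
  by rewrite /B; ring.
rewrite -[leRHS](mulrA A B) ler_wpM2r ?(ltW h5) //.
by rewrite !mulr_ge0 ?cabs_ge0 ?addr_ge0 ?cabs_ge0.
Qed.

Lemma cderiv_cst c z : cderiv (fun=> c) z 0.
Proof.
move=> e e0; exists 1 => // h _ /=; rewrite subrr mulr0 subrr cabs0.
by rewrite mulr_ge0 ?cabs_ge0 // ltW.
Qed.

Lemma cderiv_id z : cderiv id z 1.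
Proof.
move=> e e0; exists 1 => // h _ /=; rewrite (addrAC z) subrr add0r mulr1 subrr cabs0.
by rewrite mulr_ge0 ?cabs_ge0 // ltW.
Qed.

Lemma cderivZ (c : R[i]) f z l : cderiv f z l -> cderiv (fun w => c * f w) z (c * l).
Proof.
by move=> df; have := cderivM (cderiv_cst c z) df; rewrite mul0r add0r.
Qed.

Lemma cderivB f g z l m : cderiv f z l -> cderiv g z m ->
  cderiv (fun w => f w - g w) z (l - m).
Proof.
move=> df dg; have := cderivD df (cderivZ (-1) dg).
by rewrite mulN1r; congr cderiv; apply/funext => w; rewrite mulN1r.
Qed.

Lemma cderiv_sum I (r : seq I) (P : pred I) (f : I -> R[i] -> R[i]) z (l : I -> R[i]) :
  (forall i, P i -> cderiv (f i) z (l i)) ->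
  cderiv (fun w => \sum_(i <- r | P i) f i w) z (\sum_(i <- r | P i) l i).
Proof.
move=> h; elim: r => [|i r IH].
  under eq_fun do rewrite big_nil.
  rewrite big_nil; exact: cderiv_cst.
under eq_fun do rewrite big_cons; rewrite big_cons.
by case: ifP => // Pi; exact: (cderivD (h i Pi) IH).
Qed.

Lemma cderiv_continuous f z l : cderiv f z l -> f w @[w --> z] --> f z.
Proof.
move=> /cderiv_lip[d d0 hd]; apply/(cvg_cabsP (F := nbhs z)) => e e0.
have k0 : 0 < cabs l + 1 by rewrite ltr_wpDl ?cabs_ge0.
apply/nbhs_cabsP; exists (Num.min d (e / (cabs l + 1))).
  by rewrite lt_min d0 divr_gt0.
move=> w; rewrite lt_min ltr_pdivlMr // mulrC => /andP[wd we].
have := hd _ wd; rewrite subrKC; move/le_lt_trans; exact.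
Qed.

Lemma cderiv_comp f g z l m : cderiv g z m -> cderiv f (g z) l ->
  cderiv (fun w => f (g w)) z (l * m).
Proof.
move=> dg df e e0.
have [d1 d10 h1] := cderiv_lip dg.
set k := cabs m + 1; have k0 : 0 < k by rewrite ltr_wpDl ?cabs_ge0.
have l0 : 0 < cabs l + 1 by rewrite ltr_wpDl ?cabs_ge0.
have e1 : 0 < e / 2 / k by rewrite !divr_gt0.
have e2 : 0 < e / 2 / (cabs l + 1) by rewrite !divr_gt0.
have [d2 d20 h2] := df _ e1.
have [d3 d30 h3] := dg _ e2.
exists (Num.min d1 (Num.min d3 (d2 / k))).
  by rewrite !lt_min d10 d30 divr_gt0.
move=> h; rewrite !lt_min ltr_pdivlMr // [_ * k]mulrC => /and3P[hd1 hd3 hd2].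
have {}h1 := h1 _ hd1; have {}h3 := h3 _ hd3.
set u := g (z + h) - g z in h1 h3.
have {}h2 := h2 u (le_lt_trans h1 hd2).
have gE : g (z + h) = g z + u by rewrite /u subrKC.
rewrite gE.
have -> : f (g z + u) - f (g z) - h * (l * m) =
  (f (g z + u) - f (g z) - u * l) + (u - h * m) * l by ring.
apply: le_trans (cabsD _ _) _; rewrite cabsM.
have -> : e * cabs h = e / 2 / k * (k * cabs h) +
   e / 2 / (cabs l + 1) * cabs h * (cabs l + 1).
  have := lt0r_neq0 k0; have := lt0r_neq0 l0 => *; field.
  by apply/andP.
apply: lerD.
  by apply: le_trans h2 _; rewrite ler_wpM2l // ltW.
apply: ler_pM; rewrite ?cabs_ge0 //; lra.
Qed.

Lemma cderivV z : z != 0 -> cderiv (fun w => w^-1) z (- z ^- 2).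
Proof.
move=> z0; have Z0 : 0 < cabs z by rewrite cabs_gt0.
move=> e e0; set a := cabs z in Z0 *.
have a3 : 0 < a ^+ 3 by rewrite exprn_gt0.
(* The radius a / 2 keeps |z + h| above a / 2, so the remainder h^2 / (z^2 (z + h)) is at most 2
   |h|^2 / a^3; the second radius turns this into e |h|. *)
exists (Num.min (a / 2) (e * a ^+ 3 / 2)).
  by rewrite lt_min !divr_gt0 // mulr_gt0.
move=> h; rewrite lt_min => /andP[ha he].
have zh : a / 2 < cabs (z + h).
  have := cabsD (z + h) (- h); rewrite addrK cabsN -/a; lra.
have zh0 : z + h != 0 by rewrite -cabs_gt0; apply: le_lt_trans zh; lra.
have -> : (z + h)^-1 - z^-1 - h * - z ^- 2 = h ^+ 2 / (z ^+ 2 * (z + h)).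
  by field; rewrite z0 zh0.
rewrite cabsM cabsV cabsM !cabsX -/a.
have Z1 : 0 < cabs (z + h) by rewrite cabs_gt0.
rewrite ler_pdivrMr ?mulr_gt0 ?exprn_gt0 // expr2 mulrAC.
rewrite ler_wpM2r ?cabs_ge0 //; apply: ltW (lt_trans he _).
rewrite -mulrA ltr_pM2l // exprSr -mulrA ltr_pM2l //.
by rewrite exprn_gt0.
Qed.

(** The mean value theorem is available for real-valued functions only; p stands for the real or the
    imaginary part, of which additivity and |p x| <= |x| are all that is used. *)
Lemma cderiv0_segment_part (p : R[i] -> R) (g : R[i] -> R[i]) (c d : R[i]) :
  {morph p : x y / x - y} -> (forall x, `|p x| <= cabs x) ->
  (forall t : R, 0 <= t <= 1 -> cderiv g (c + t%:C * d) 0) ->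
  p (g (c + d)) = p (g c).
Proof.
move=> pB ple dg; pose u (t : R) := p (g (c + t%:C * d)).
have k0 : 0 < cabs d + 1 by rewrite ltr_wpDl ?cabs_ge0.
have du (t : R) : 0 <= t <= 1 -> is_derive t 1 u 0.
  move=> /dg dgt.
  have E : (fun h => h^-1 *: (u (h *: (1:R) + t) - u t)) @ 0^' --> (0:R).
    apply/cvgr0Pnorm_le => e e0.
    have e1 : 0 < e / (cabs d + 1) by rewrite divr_gt0.
    have [r r0 hr] := dgt _ e1.
    near=> h.
    have h0 : h != 0 by near: h; exact: nbhs_dnbhs_neq.
    have hlt : `|h| < r / (cabs d + 1).
      near: h; apply: dnbhs0_lt; exact: divr_gt0.
    have hd : cabs (h%:C * d) <= `|h| * (cabs d + 1).
      by rewrite cabsM cabs_real ler_wpM2l // lerDl.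
    have := hr (h%:C * d); rewrite mulr0 subr0 => /(_ _) h1.
    have {}h1 : cabs (g (c + t%:C * d + h%:C * d) - g (c + t%:C * d)) <= e * `|h|.
      apply: le_trans (h1 _) _.
        by apply: le_lt_trans hd _; rewrite -ltr_pdivlMr.
      rewrite -[e in leRHS](divfK (lt0r_neq0 k0)) -[leRHS]mulrA.
      by rewrite ler_pM2l // [leRHS]mulrC.
    rewrite normrM normfV ler_pdivrMl ?normr_gt0 // mulrC.
    rewrite /u [h *: _]mulr1 -pB; apply: le_trans (ple _) _.
    by rewrite rmorphD mulrDl [X in c + X]addrC addrA.
  have D : derivable u t 1 by apply/cvg_ex; exists 0.
  by split => //; apply/cvg_lim.
have uC : {within `[(0:R), 1], continuous u}.
  apply: continuous_in_subspaceT => t; rewrite inE /= in_itv /= => /du D.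
  by apply: differentiable_continuous; apply/derivable1_diffP; case: D.
have du' (t : R) : t \in `](0:R), 1[ -> is_derive t 1 u ((fun=> 0 : R) t).
  by rewrite in_itv /= => /andP[t0 t1]; apply: du; rewrite !ltW.
have [t _] := MVT (@ltr01 R) du' uC; rewrite mul0r => /eqP; rewrite subr_eq0.
by rewrite /u mul1r mul0r addr0 => /eqP.
Unshelve. all: by end_near. Qed.

Lemma cderiv0_segment (g : R[i] -> R[i]) (c d : R[i]) :
  (forall t : R, 0 <= t <= 1 -> cderiv g (c + t%:C * d) 0) -> g (c + d) = g c.
Proof.
move=> h; apply/eqP; rewrite eq_complex; apply/andP; split; apply/eqP.
  apply: (@cderiv0_segment_part (@complex.Re R)) => // [x y|x].
    by rewrite ReD ReN.
  exact: Re_le_cabs.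
apply: (@cderiv0_segment_part (@complex.Im R)) => // [x y|x].
  by rewrite ImD ImN.
exact: Im_le_cabs.
Qed.

End ComplexDerivative.

(** * The principal logarithm *)

Section ComplexLogarithm.
Variable R : realType.
Implicit Types (z w : R[i]) (r t : R).

Definition polar r t : R[i] := (r * cos t) +i* (r * sin t).

Lemma cabs_polar r t : 0 <= r -> cabs (polar r t) = r.
Proof.
move=> r0; rewrite cabsE /= !exprMn -mulrDr cos2Dsin2 mulr1 sqrtr_sqr.
by rewrite ger0_norm.
Qed.

Lemma polarM r t r' t' : polar r t * polar r' t' = polar (r * r') (t + t').
Proof.
rewrite /polar [LHS](_ : _ = (r * cos t * (r' * cos t') - r * sin t * (r' * sin t'))
  +i* (r * cos t * (r' * sin t') + r * sin t * (r' * cos t'))) //.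
by rewrite cosD sinD; congr (_ +i* _); ring.
Qed.

Lemma carg_polar r t : 0 < r -> - pi < t <= pi -> carg (polar r t) = t.
Proof.
move=> r0 /andP[tN tp]; rewrite /carg (cabs_polar _ (ltW r0)) /=.
rewrite [r * cos t]mulrC mulfK ?gt_eqF //.
rewrite pmulr_rge0 //.
case: (leP 0 t) => t0.
  by rewrite sin_ge0_pi ?t0 // cosK // in_itv /= t0.
have s0 : 0 < sin (- t) by rewrite sin_gt0_pi // oppr_gt0 t0 ltrNl.
rewrite sinN oppr_gt0 in s0; rewrite leNgt s0 /= cosKN ?opprK // (ltW tN).
exact: ltW.
Qed.

Lemma carg_bound z : z != 0 -> -1 <= complex.Re z / cabs z <= 1.
Proof.
rewrite -cabs_gt0 => z0; rewrite -ler_norml normrM normfV (ger0_norm (cabs_ge0 _)).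
by rewrite ler_pdivrMr // mul1r Re_le_cabs.
Qed.

Lemma polar_carg z : z != 0 -> z = polar (cabs z) (carg z).
Proof.
move=> z0; have zb := carg_bound z0; have Z0 : 0 < cabs z by rewrite cabs_gt0.
have hc : cos (acos (complex.Re z / cabs z)) = complex.Re z / cabs z.
  by rewrite acosK // in_itv.
have hs : cabs z * sin (acos (complex.Re z / cabs z)) = `|complex.Im z|.
  rewrite sin_acos //.
  transitivity (Num.sqrt (cabs z ^+ 2) * Num.sqrt (1 - (complex.Re z / cabs z) ^+ 2)).
    by rewrite sqrtr_sqr (ger0_norm (ltW Z0)).
  rewrite -sqrtrM ?sqr_ge0 //.
  rewrite -[RHS]sqrtr_sqr; congr Num.sqrt.
  have aux (a x : R) : a != 0 -> a ^+ 2 * (1 - (x / a) ^+ 2) = a ^+ 2 - x ^+ 2.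
    by move=> a0; field.
  rewrite aux ?gt_eqF //.
  by rewrite cabsE sqr_sqrtr ?addr_ge0 ?sqr_ge0 // addrC addKr.
rewrite {1}[z](_ : _ = complex.Re z +i* complex.Im z); last by case: (z).
rewrite /polar /carg; case: (leP 0 (complex.Im z)) => im0.
  rewrite hc hs ger0_norm //; congr (_ +i* _).
  by rewrite mulrC divfK // gt_eqF.
rewrite cosN sinN mulrN hc hs ltr0_norm // opprK; congr (_ +i* _).
by rewrite mulrC divfK // gt_eqF.
Qed.

Lemma carg_gtNpi z : z != 0 -> - pi < carg z.
Proof.
move=> z0; have zb := carg_bound z0; rewrite /carg; case: (leP 0 (complex.Im z)) => im0.
  by apply: lt_le_trans (acos_ge0 zb); rewrite oppr_lt0 pi_gt0.
rewrite ltrN2; apply: acos_ltpi; case/andP: zb => + ->; rewrite andbT.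
(* Equality would force Re z = - |z|, hence Im z = 0, which this branch excludes. *)
rewrite le_eqVlt => /orP[/eqP e|//]; exfalso.
have Z0 : 0 < cabs z by rewrite cabs_gt0.
have : cabs z ^+ 2 = complex.Re z ^+ 2.
  by rewrite -[complex.Re z](divfK (lt0r_neq0 Z0)) -e mulN1r sqrrN.
rewrite cabsE sqr_sqrtr ?addr_ge0 ?sqr_ge0 // -[RHS]addr0 => /addrI /eqP.
by rewrite sqrf_eq0 lt_eqF.
Qed.

Lemma carg_lepi z : z != 0 -> carg z <= pi.
Proof.
move=> z0; have zb := carg_bound z0; rewrite /carg; case: (leP 0 (complex.Im z)) => im0.
  exact: acos_lepi.
by apply: le_trans (_ : 0 <= _); rewrite ?pi_ge0 // oppr_le0 acos_ge0.
Qed.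

Lemma carg_gt0 z : 0 < complex.Im z -> 0 < carg z < pi.
Proof.
move=> i0; have z0 : z != 0 by apply: contraTneq i0 => ->; rewrite ltxx.
have := polar_carg z0 => /(congr1 (@complex.Im R)) /=.
have := carg_lepi z0; rewrite /carg (ltW i0) => h e.
have h0 := acos_ge0 (carg_bound z0).
rewrite !lt_def h h0 !andbT; apply/andP; split; apply/eqP => h1; move: i0.
  by rewrite e h1 sin0 mulr0 ltxx.
by rewrite e -h1 sinpi mulr0 ltxx.
Qed.

(** The definition through [acos] is not differentiable where Re z = |z|, in particular at 1, where
    the derivative of the logarithm is computed; the arctangent is smooth there. *)
Lemma carg_Re_gt0 z : 0 < complex.Re z -> carg z = atan (complex.Im z / complex.Re z).
Proof.
move=> r0; have z0 : z != 0 by apply: contraTneq r0 => ->; rewrite ltxx.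
have Z0 : 0 < cabs z by rewrite cabs_gt0.
set t := atan _.
have ct : 0 < cos t by apply: cos_gt0_pihalf; rewrite atan_gtNpi2 atan_ltpi2.
have tE : sin t = complex.Im z / complex.Re z * cos t.
  by rewrite -[_ / complex.Re z]atanK -/t /tan divfK // gt_eqF.
have pi0 := pi_gt0 R.
rewrite {1}(_ : z = polar (complex.Re z / cos t) t).
  rewrite carg_polar // ?divr_gt0 //.
  have := atan_gtNpi2 (complex.Im z / complex.Re z).
  have := atan_ltpi2 (complex.Im z / complex.Re z); rewrite -/t.
  by move=> h1 h2; apply/andP; split; lra.
rewrite /polar divfK ?gt_eqF // tE mulrCA !divfK ?gt_eqF //.
by case: (z).
Qed.

Lemma carg_Re_gt0_bound z : 0 < complex.Re z -> - (pi / 2) < carg z < pi / 2.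
Proof. by move=> /carg_Re_gt0 ->; rewrite atan_gtNpi2 atan_ltpi2. Qed.

Lemma clogM z w : z != 0 -> w != 0 -> - pi < carg z + carg w <= pi ->
  clog (z * w) = clog z + clog w.
Proof.
move=> z0 w0 h; have Z0 : 0 < cabs z by rewrite cabs_gt0.
have W0 : 0 < cabs w by rewrite cabs_gt0.
rewrite /clog; apply/eqP; rewrite eq_complex; apply/andP; split; apply/eqP.
  by rewrite /= cabsM lnM // posrE.
by rewrite /= {1}(polar_carg z0) {1}(polar_carg w0) polarM carg_polar // mulr_gt0.
Qed.

(** Turning by - pi moves an argument in ]0, pi[ to ]- pi, 0[, still inside the principal range. All
    the factors pi i of the theorem originate here. *)
Lemma clogN_Im_gt0 z : 0 < complex.Im z -> clog (- z) = clog z - (0 +i* pi).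
Proof.
move=> i0; have z0 : z != 0 by apply: contraTneq i0 => ->; rewrite ltxx.
have /andP[h1 h2] := carg_gt0 i0; have pi0 := pi_gt0 R.
have Z0 : 0 < cabs z by rewrite cabs_gt0.
have E : - z = polar (cabs z) (carg z - pi).
  rewrite {1}(polar_carg z0) /polar -[in RHS](opprB pi) cosN sinN.
  rewrite [pi - _]addrC cosDpi sinDpi cosN sinN !opprK.
  by apply/eqP; rewrite eq_complex /= !mulrN !eqxx.
have cE : carg (- z) = carg z - pi.
  by rewrite E carg_polar //; apply/andP; split; lra.
apply/eqP; rewrite eq_complex ReD ReN ImD ImN /= cabsN cE oppr0 addr0.
by rewrite !eqxx.
Qed.

Lemma clogN_Im_lt0 z : complex.Im z < 0 -> clog (- z) = clog z + (0 +i* pi).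
Proof.
move=> i0; have i1 : 0 < complex.Im (- z) by rewrite ImN oppr_gt0.
by have := clogN_Im_gt0 i1; rewrite opprK => ->; rewrite subrK.
Qed.

(** The lower bound for ln (1 + s) is the upper bound ln (1 + x) <= x applied to the inverse of 1 +
    s, which is 1 - s / (1 + s); s >= - 1/2 gives 1 / (1 + s) <= 2. *)
Lemma ln1D_bound (s : R) : -(1/2) <= s -> `|ln (1 + s) - s| <= 2 * s ^+ 2.
Proof.
move=> s0.
have h1 : ln (1 + s) <= s by apply: le_ln1Dx; lra.
have s1 : 0 < 1 + s by lra.
have h2 : - ln (1 + s) <= - s / (1 + s).
  rewrite -lnV ?posrE //.
  have -> : ln (1 + s)^-1 = ln (1 + - s / (1 + s)).
    by congr ln; field; rewrite gt_eqF.
  by apply: le_ln1Dx; rewrite ltr_pdivlMr //; lra.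
rewrite ler0_norm ?subr_le0 // opprB.
have h3 : - s / (1 + s) + s <= 2 * s ^+ 2.
  rewrite (_ : - s / (1 + s) + s = s ^+ 2 / (1 + s)); last first.
    by field; rewrite gt_eqF.
  rewrite ler_pdivrMr //; have := sqr_ge0 s; nra.
by lra.
Qed.

Lemma atan_bound (e : R) : 0 < e -> exists2 d : R, 0 < d &
  forall t : R, `|t| < d -> `|atan t - t| <= e * `|t|.
Proof.
move=> e0; have [D V] := is_derive1_atan (0 : R).
have : (fun h : R => h^-1 *: (atan (h *: (1:R) + 0) - atan 0)) @ 0^' --> (1 : R).
  rewrite [X in _ --> X](_ : 1 = 'D_1 atan (0:R)); first exact: D.
  by rewrite V expr0n addr0 invr1.
move=> /cvgrPdist_le /(_ _ e0); rewrite /dnbhs /within /= => /nbhs_ballP[d /= d0 h].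
exists d => // t td; have [->|t0] := eqVneq t 0.
  by rewrite atan0 subrr normr0 mulr0.
have := h t; rewrite /ball /= sub0r normrN => /(_ td t0).
rewrite atan0 subr0 addr0 [t *: _]mulr1 distrC => hh.
have -> : atan t - t = (t^-1 *: atan t - 1) * t.
  by rewrite /GRing.scale /=; field.
by rewrite normrM ler_wpM2r.
Qed.

Lemma cderiv_clog1 : cderiv (@clog R) 1 1.
Proof.
move=> e e0; have e4 : 0 < e / 8 by lra.
have [d d0 hd] := atan_bound e4.
(* Below e / 40, a^2 is at most (e / 40) a, and the real part costs at most 19/2 a^2. The bound d /
   2 makes |t| <= 2 a small enough for the estimate of the arctangent. *)
exists (Num.min (Num.min (1/8) (d / 2)) (e / 40)).
  by rewrite !lt_min; apply/andP; split; [apply/andP; split|]; lra.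
move=> h; rewrite !lt_min => /andP[/andP[h8 hd2] he].
rewrite (_ : clog 1 = 0); last first.
  rewrite /clog cabs1 ln1 carg_Re_gt0 /= ?ltr01 // mul0r atan0 //.
rewrite subr0 mulr1.
have hx := Re_le_cabs h; have hy := Im_le_cabs h.
set x := complex.Re h in hx; set y := complex.Im h in hy; set a := cabs h in h8 hd2 he hx hy *.
have a0 : 0 <= a by exact: cabs_ge0.
have a2 : a ^+ 2 = x ^+ 2 + y ^+ 2 by rewrite /a cabsE sqr_sqrtr ?addr_ge0 ?sqr_ge0.
have [hx1 hx2] : - a <= x /\ x <= a by apply/andP; rewrite -ler_norml.
have a8 : a ^+ 2 <= a / 8 by nra.
have ae : a ^+ 2 <= e / 40 * a by nra.
have ReE : complex.Re (1 + h) = 1 + x by rewrite ReD.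
have ImE : complex.Im (1 + h) = y by rewrite ImD add0r.
apply: le_trans (cabs_le _) _.
rewrite (_ : e * a = e / 2 * a + e / 2 * a); last by field.
rewrite ReD ReN ImD ImN /= -/x -/y; apply: lerD.
  (* This is |1 + h|^2 - 1, so that ln |1 + h| is half of ln (1 + s) and no square root has to be
     estimated. *)
  set s := 2 * x + a ^+ 2.
  have sb : - (1/2) <= s by rewrite /s; nra.
  have := ln1D_bound sb.
  have -> : ln (1 + s) = 2 * ln (cabs (1 + h)).
    have c0 : 0 < cabs (1 + h).
      rewrite cabs_gt0; apply: contraTneq isT => /(congr1 (@complex.Re R)).
      by rewrite ReE /=; lra.
    rewrite mulr_natl -lnXn //; congr ln.
    by rewrite cabsE sqr_sqrtr ?addr_ge0 ?sqr_ge0 // ReE ImE /s a2; ring.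
  rewrite !ler_norml => /andP[h1 h2].
  have s2 : s ^+ 2 <= 9 * a ^+ 2 by rewrite /s; nra.
  rewrite /s in h1 h2 s2.
  by apply/andP; split; nra.
have x1 : 0 < 1 + x by lra.
rewrite carg_Re_gt0 ?ReE // ImE; set t := y / (1 + x).
have tE : t * (1 + x) = y by rewrite /t divfK // gt_eqF.
have tn : `|t| * (1 + x) = `|y| by rewrite /t normrM normfV (gtr0_norm x1) divfK // gt_eqF.
have ta : `|t| <= 2 * a by have := normr_ge0 t; nra.
have td : `|t| < d by lra.
have {}hd := hd _ td.
rewrite (_ : atan t - y = (atan t - t) - t * x); last by rewrite -tE; ring.
apply: le_trans (ler_normB _ _) _; rewrite normrM.
have xn : `|x| <= a by [].
have : `|t| * `|x| <= 2 * a * a by apply: ler_pM.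
have : e / 8 * `|t| <= e / 8 * (2 * a) by rewrite ler_pM2l.
have : 0 <= e * a by rewrite mulr_ge0 // ltW.
move: hd ae; rewrite expr2; lra.
Qed.

Definition slit : set R[i] := ~` [set z | complex.Im z = 0 /\ complex.Re z <= 0].

Lemma slit_neq0 z : slit z -> z != 0.
Proof. by move=> h; apply/eqP => z0; apply: h; rewrite /= z0 /= lexx. Qed.

Lemma carg_slit z : slit z -> - pi < carg z < pi.
Proof.
move=> h; have z0 := slit_neq0 h; rewrite carg_gtNpi //= lt_def carg_lepi // andbT.
apply/eqP => e; apply: h; rewrite /= {1 2}(polar_carg z0) -e /= cospi sinpi mulr0.
by split=> //; rewrite mulrN1 oppr_le0 cabs_ge0.
Qed.

(** Reduction to the point 1: log w = log (w / z) + log z holds near z, as soon as the argument of w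
    / z is smaller than the distance m from arg z to the ends of the principal range. *)
Lemma cderiv_clog z : slit z -> cderiv (@clog R) z z^-1.
Proof.
move=> sz; have z0 := slit_neq0 sz; have Z0 : 0 < cabs z by rewrite cabs_gt0.
have /andP[c1 c2] := carg_slit sz.
pose m := Num.min (pi - carg z) (carg z + pi).
have m0 : 0 < m by rewrite lt_min; apply/andP; split; lra.
have [d d0 hd] := cderiv_lip cderiv_clog1.
have l1 : clog 1 = 0 :> R[i].
  by rewrite /clog cabs1 ln1 carg_Re_gt0 /= ?ltr01 // mul0r atan0.
apply: (@cderiv_ext _ (fun w => clog (z^-1 * w) + clog z)).
  apply/nbhs_cabsP; exists (Num.min 1 (Num.min d (m / 2)) * cabs z).
    by rewrite mulr_gt0 // !lt_min ltr01 d0 divr_gt0.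
  move=> w hw; set h := z^-1 * w - 1.
  have hE : cabs (w - z) = cabs h * cabs z.
    by rewrite -cabsM /h; congr cabs; field.
  move: hw; rewrite hE ltr_pM2r // !lt_min => /and3P[k1 k2 k3].
  have := hd _ k2; rewrite l1 subr0 cabs1 /h subrKC => k4.
  have := Im_le_cabs (clog (z^-1 * w)); rewrite /= => k5.
  have /andP[k6 k7] : - m < carg (z^-1 * w) < m.
    by rewrite -ltr_norml; apply: le_lt_trans k5 (le_lt_trans k4 _); rewrite -/h; lra.
  have [m1 m2] : m <= pi - carg z /\ m <= carg z + pi.
    by rewrite /m !ge_min !lexx orbT.
  rewrite -clogM //.
  - by rewrite mulrAC mulVf // mul1r.
  - apply: contraTneq k1 => w0; rewrite /h w0 sub0r cabsN cabs1 ltxx //.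
  - by apply/andP; split; lra.
have dl : cderiv (fun w => z^-1 * w) z z^-1.
  by have := cderivZ z^-1 (cderiv_id z); rewrite mulr1.
have h1 : cderiv (@clog R) (z^-1 * z) 1 by rewrite mulVf //; exact: cderiv_clog1.
by have := cderivD (cderiv_comp dl h1) (cderiv_cst (clog z) z); rewrite addr0 mul1r.
Qed.

End ComplexLogarithm.

(** * Power series and the identity theorem *)

Section PowerSeries.
Variable R : realType.
Implicit Types (c : nat -> R[i]) (w z a h s : R[i]) (r q M : R).

Lemma cvgD_complex T (F : set_system T) {FF : Filter F} (f g : T -> R[i]) (a b : R[i]) :
  f @ F --> a -> g @ F --> b -> (fun x => f x + g x) @ F --> a + b.
Proof.
move=> /cvg_cabsP fa /cvg_cabsP gb; apply/cvg_cabsP => e e0.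
have e20 : 0 < e / 2 by lra.
apply: filterS2 (fa _ e20) (gb _ e20) => x /= h1 h2.
by have := cabsD (f x - a) (g x - b); rewrite addrACA -opprD; lra.
Qed.

Lemma cvgM_complex T (F : set_system T) {FF : Filter F} (f g : T -> R[i]) (a b : R[i]) :
  f @ F --> a -> g @ F --> b -> (fun x => f x * g x) @ F --> a * b.
Proof.
move=> /cvg_cabsP fa /cvg_cabsP gb; apply/cvg_cabsP => e e0.
have pos x : 0 < cabs x + 1 by rewrite ltr_wpDl ?cabs_ge0.
pose k := cabs a + cabs b + 1.
have k0 : 0 < k by rewrite ltr_wpDl ?addr_ge0 ?cabs_ge0.
pose d := Num.min 1 (e / 2 / k).
have d0 : 0 < d by rewrite lt_min ltr01 !divr_gt0.
apply: filterS2 (fa _ d0) (gb _ d0) => x /= h1 h2.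
have -> : f x * g x - a * b = (f x - a) * (g x - b) + ((f x - a) * b + a * (g x - b)).
  by ring.
apply: le_lt_trans (cabsD _ _) _.
have := cabsD ((f x - a) * b) (a * (g x - b)); rewrite !cabsM => h3.
have [d1 d2] : d <= 1 /\ d * k <= e / 2.
  by rewrite -ler_pdivlMr // /d !ge_min !lexx orbT.
have := cabs_ge0 a; have := cabs_ge0 b.
have := cabs_ge0 (f x - a); have := cabs_ge0 (g x - b).
move: h1 h2 h3 d1 d2; rewrite /k.
move: (cabs (f x - a)) (cabs (g x - b)) (cabs a) (cabs b) (cabs ((f x - a) * b + _)).
move=> u v A B W.
move=> h1 h2 h3 d1 d2 v0 u0 B0 A0.
have : u * v <= d * v by rewrite ler_wpM2r // ltW.
have : d * v <= d * 1 by rewrite ler_wpM2l; lra.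
have : u * B <= d * B by rewrite ler_wpM2r // ltW.
have : A * v <= A * d by rewrite ler_wpM2l // ltW.
lra.
Qed.

Lemma cvg_cst_complex T (F : set_system T) {FF : Filter F} (a : R[i]) : (fun=> a : R[i]) @ F --> a.
Proof. by apply: cvg_cst_cabs; apply: filterE. Qed.

Lemma cvg_sum_complex T (F : set_system T) {FF : Filter F} I (r : seq I) (P : pred I)
  (f : I -> T -> R[i]) (l : I -> R[i]) :
  (forall i, P i -> f i @ F --> l i) ->
  (fun x => \sum_(i <- r | P i) f i x) @ F --> \sum_(i <- r | P i) l i.
Proof.
move=> h; elim: r => [|i r IH].
  under eq_fun do rewrite big_nil; rewrite big_nil; exact: cvg_cst_complex.
rewrite big_cons; case: ifP => Pi; last first.
  by under eq_fun do rewrite big_cons Pi.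
under eq_fun do rewrite big_cons Pi.
exact: (cvgD_complex (h i Pi) IH).
Qed.

Lemma cvgB_complex T (F : set_system T) {FF : Filter F} (f g : T -> R[i]) (a b : R[i]) :
  f @ F --> a -> g @ F --> b -> (fun x => f x - g x) @ F --> a - b.
Proof.
move=> fa gb; rewrite -(mulN1r b).
have -> : (fun x => f x - g x) = (fun x => f x + -1 * g x).
  by apply/funext => x; rewrite mulN1r.
exact: (cvgD_complex fa (cvgM_complex (@cvg_cst_complex _ _ _ (-1 : R[i])) gb)).
Qed.

Lemma cvg_shiftS_complex (u : nat -> R[i]) (l : R[i]) :
  u @ \oo --> l -> (fun n => u n.+1) @ \oo --> l.
Proof.
move=> /cvg_cabsP h; apply/cvg_cabsP => e e0; have [N _ hN] := h _ e0.
by exists N => // n /= Nn; apply: hN; rewrite /= (leq_trans Nn).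
Qed.

Lemma cabs_lim_le T (F : set_system T) {FF : ProperFilter F} (f : T -> R[i]) (a : R[i]) M :
  f @ F --> a -> (forall x, cabs (f x) <= M) -> cabs a <= M.
Proof.
move=> /cvg_cabsP fa fM; apply/ler_addgt0Pr => e e0.
have [x hx] := filter_ex (fa _ e0).
have := cabsD (a - f x) (f x); rewrite subrK cabsB.
by have := fM x; lra.
Qed.

Definition psum c w s := series (fun n => c n * w ^+ n) @ \oo --> s.

Lemma psum_unique c w s s' : psum c w s -> psum c w s' -> s = s'.
Proof. exact: cvg_unique_complex. Qed.

(** A substitute for the radius of convergence: convergence at w yields it for r = |w|, and it
    yields convergence for |w| < r. *)
Definition cbounded c r := exists2 M : R, 0 <= M & forall n, cabs (c n) * r ^+ n <= M.

Lemma series_term_cvg0 (u : nat -> R[i]) s : series u @ \oo --> s -> u @ \oo --> (0 : R[i]).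
Proof.
move=> h; have E : u = (fun n => series u n.+1 - series u n).
  apply/funext => n; rewrite seriesEnat /= big_nat_recr //=.
  by rewrite addrAC subrr add0r.
rewrite E -(subrr s); exact: (cvgB_complex (cvg_shiftS_complex h) h).
Qed.

Lemma psum_bounded c w s : psum c w s -> cbounded c (cabs w).
Proof.
move=> h; pose u n := c n * w ^+ n.
have u0 : u @ \oo --> (0 : R[i]).
  exact: series_term_cvg0 h.
have /cvg_cabsP /(_ 1 ltr01) [N _ hN] := u0.
exists (1 + \sum_(i < N) cabs (u i)).
  by rewrite addr_ge0 ?sumr_ge0 // => i _; exact: cabs_ge0.
move=> n; rewrite -cabsX -cabsM -/(u n); case: (ltnP n N) => nN.
  rewrite (bigD1 (Ordinal nN)) //= addrCA lerDl addr_ge0 // ?sumr_ge0 // => i _.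
  exact: cabs_ge0.
have := hN n nN; rewrite /= subr0 => /ltW /le_trans; apply.
by rewrite lerDl sumr_ge0 // => i _; exact: cabs_ge0.
Qed.

Lemma geo_bound q N : 0 <= q < 1 -> \sum_(n < N) q ^+ n <= (1 - q)^-1.
Proof.
move=> /andP[q0 q1]; have d0 : 0 < 1 - q by lra.
rewrite -[leRHS]mul1r ler_pdivlMr // mulrC.
have -> : (1 - q) * \sum_(n < N) q ^+ n = 1 - q ^+ N.
  elim: N => [|N IH]; first by rewrite big_ord0 expr0 subrr mulr0.
  by rewrite big_ord_recr /= mulrDr IH exprS; ring.
by rewrite gerBl exprn_ge0.
Qed.

(** The weight n^2 is the one of the Taylor remainder in [exp_taylor]. The full series is q (1 + q)
    / (1 - q)^3, and the closed form of a partial sum only subtracts a nonnegative term from it. *)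
Lemma sqr_geo_bound q N : 0 <= q < 1 ->
  \sum_(n < N) n%:R ^+ 2 * q ^+ n <= 2 * (1 - q) ^- 3.
Proof.
move=> /andP[q0 q1]; have d0 : 0 < 1 - q by lra.
rewrite ler_pdivlMr ?exprn_gt0 // mulrC.
have -> : (1 - q) ^+ 3 * \sum_(n < N) n%:R ^+ 2 * q ^+ n =
  q * (1 + q) - q ^+ N * (N%:R ^+ 2 * (1 - q) ^+ 2 + 2 * N%:R * q * (1 - q) + q * (1 + q)).
  elim: N => [|N IH]; first by rewrite big_ord0 expr0; ring.
  by rewrite big_ord_recr /= mulrDr IH [q ^+ N.+1]exprS -[N.+1%:R]natr1; ring.
have : 0 <= q ^+ N * (N%:R ^+ 2 * (1 - q) ^+ 2 + 2 * N%:R * q * (1 - q) + q * (1 + q)).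
  rewrite mulr_ge0 ?exprn_ge0 //; have d0' := ltW d0.
  have h1 : 0 <= N%:R ^+ 2 * (1 - q) ^+ 2 by rewrite mulr_ge0 ?sqr_ge0.
  have h2 : 0 <= 2 * N%:R * q * (1 - q) by rewrite !mulr_ge0.
  have h3 : 0 <= q * q by rewrite mulr_ge0.
  by rewrite mulrDr mulr1; lra.
have : q * (1 + q) <= 2 by nra.
by lra.
Qed.

Lemma psum_cvg c r w : cbounded c r -> cabs w < r -> exists s, psum c w s.
Proof.
move=> [M M0 cM] wr; have r0 : 0 < r by apply: le_lt_trans wr; exact: cabs_ge0.
pose u n := c n * w ^+ n; pose q := cabs w / r.
have q0 : 0 <= q by rewrite divr_ge0 ?cabs_ge0 // ltW.
have q1 : q < 1 by rewrite ltr_pdivrMr // mul1r.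
have uq n : cabs (u n) <= geometric M q n.
  rewrite /geometric /= cabsM cabsX.
  have -> : cabs w ^+ n = r ^+ n * q ^+ n by rewrite -exprMn mulrC divfK // gt_eqF.
  by rewrite mulrA ler_wpM2r ?exprn_ge0.
have cvgp (p : R[i] -> R) : (forall x, `|p x| <= cabs x) ->
    cvgn (series (fun n => p (u n))).
  move=> hp; apply: normed_cvg; apply: (@series_le_cvg _ _ (geometric M q)).
  - by move=> n; exact: normr_ge0.
  - by move=> n; rewrite /geometric /= mulr_ge0 ?exprn_ge0.
  - by move=> n; apply: le_trans (uq n); exact: hp.
  - by apply: is_cvg_geometric_series; rewrite ger0_norm.
have /cvg_ex[/= x hx] := cvgp _ (@Re_le_cabs R).
have /cvg_ex[/= y hy] := cvgp _ (@Im_le_cabs R).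
exists (x +i* y); apply/cvg_cabsP => e e0; have e20 : 0 < e / 2 by lra.
move/cvgrPdist_lt : hy => /(_ _ e20); move/cvgrPdist_lt : hx => /(_ _ e20).
apply: filterS2 => n /= h1 h2; apply: le_lt_trans (cabs_le _) _.
rewrite ReD ReN ImD ImN.
have sE (p : R[i] -> R) : p 0 = 0 -> {morph p : x y / x + y} ->
    p (series u n) = series (fun n => p (u n)) n.
  by move=> p0 pD; rewrite /series /=; apply: big_morph.
rewrite (sE _ _ (@ReD R)) // (sE _ _ (@ImD R)) //= -normrN opprB.
by rewrite -[X in _ + X]normrN opprB; lra.
Qed.

Definition derseq c n : R[i] := n.+1%:R * c n.+1.

(** The loss of radius pays for the factor n + 1, since n q^n <= n^2 q^n is bounded for q = r' / r <
    1. *)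
Lemma cbounded_derseq c r r' : 0 < r' < r -> cbounded c r -> cbounded (derseq c) r'.
Proof.
move=> /andP[r'0 r'r] [M M0 cM]; have r0 : 0 < r by lra.
pose q := r' / r.
have q0 : 0 < q by rewrite divr_gt0.
have q1 : 0 <= q < 1 by rewrite ltW //= ltr_pdivrMr // mul1r.
pose K := 2 * (1 - q) ^- 3.
have hK n : n%:R ^+ 2 * q ^+ n <= K.
  apply: le_trans (sqr_geo_bound n.+1 q1); rewrite big_ord_recr /= lerDr sumr_ge0 //.
  by move=> i _; rewrite mulr_ge0 ?exprn_ge0 // ltW.
have K0 : 0 <= K by apply: le_trans (hK 0%N); rewrite mulr_ge0 ?exprn_ge0 // ltW.
exists (K * M / r').
  by apply: divr_ge0; [exact: mulr_ge0|exact: ltW].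
move=> n; rewrite ler_pdivlMr // -mulrA -exprSr /derseq cabsM cabs_nat.
have -> : r' ^+ n.+1 = q ^+ n.+1 * r ^+ n.+1.
  by rewrite -exprMn divfK // gt_eqF.
rewrite mulrACA; apply: ler_pM; rewrite ?mulr_ge0 ?exprn_ge0 ?cabs_ge0 ?(ltW r0) ?(ltW q0) //.
apply: le_trans (hK n.+1); rewrite ler_wpM2r ?exprn_ge0 ?(ltW q0) //.
by rewrite expr2 ler_peMl // ler1n.
Qed.

(** The factor r^2 on the left avoids the exponent n - 2 on the right. The crude constant n^2 is
    compatible with the recursion R_{n+1} = (w + h) R_n + n h^2 w^{n-1} of the remainders, because
    (n + 1)^2 = n^2 + (2 n + 1). *)
Lemma exp_taylor w h r n : cabs w <= r -> cabs (w + h) <= r ->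
  cabs ((w + h) ^+ n - w ^+ n - h * (n%:R * w ^+ n.-1)) * r ^+ 2 <=
  n%:R ^+ 2 * cabs h ^+ 2 * r ^+ n.
Proof.
move=> wr hr; have r0 : 0 <= r by apply: le_trans wr; exact: cabs_ge0.
elim: n => [|n IH].
  by rewrite !expr0 mul0r mulr0 !subrr cabs0 mul0r expr0n !mul0r.
have -> : (w + h) ^+ n.+1 - w ^+ n.+1 - h * (n.+1%:R * w ^+ n.+1.-1) =
  (w + h) * ((w + h) ^+ n - w ^+ n - h * (n%:R * w ^+ n.-1)) + n%:R * h ^+ 2 * w ^+ n.-1.
  case: n {IH} => [|n] /=; first by rewrite !expr1 !expr0; ring.
  rewrite -[n.+2%:R]natr1 [(w + h) ^+ n.+2]exprS [(w + h) ^+ n.+1]exprS.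
  rewrite [w ^+ n.+2]exprS [w ^+ n.+1]exprS.
  by move: (n.+1%:R) ((w + h) ^+ n) (w ^+ n) => k A W; ring.
apply: le_trans (ler_wpM2r (exprn_ge0 _ r0) (cabsD _ _)) _.
have -> : n.+1%:R ^+ 2 * cabs h ^+ 2 * r ^+ n.+1 =
  r * (n%:R ^+ 2 * cabs h ^+ 2 * r ^+ n) + (n%:R *+ 2 + 1) * cabs h ^+ 2 * r ^+ n.+1.
  by rewrite [r ^+ n.+1]exprS -[n.+1%:R]natr1; ring.
rewrite mulrDl; apply: lerD.
  by rewrite cabsM -[leLHS]mulrA ler_pM ?mulr_ge0 ?cabs_ge0 ?exprn_ge0.
rewrite !cabsM !cabsX cabs_nat.
have -> : n%:R * cabs h ^+ 2 * cabs w ^+ n.-1 * r ^+ 2 =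
   n%:R * cabs h ^+ 2 * (cabs w ^+ n.-1 * r ^+ 2) by ring.
case: n {IH} => [|n]; first by rewrite !mul0r !mulr_ge0 ?addr_ge0 ?exprn_ge0 ?cabs_ge0.
apply: ler_pM; rewrite ?mulr_ge0 ?exprn_ge0 ?cabs_ge0 //.
  by rewrite ler_wpM2r ?exprn_ge0 ?cabs_ge0 // mulr2n -addrA lerDl addr_ge0.
rewrite /= -[n.+2]addn2 exprD ler_wpM2r ?exprn_ge0 //.
by rewrite lerXn2r ?nnegrE ?cabs_ge0.
Qed.

Lemma psum_cderiv c r w s' (f : R[i] -> R[i]) : cbounded c r -> cabs w < r ->
  (\forall z \near w, psum c z (f z)) -> psum (derseq c) w s' -> cderiv f w s'.
Proof.
move=> [M M0 cM] wr /nbhs_cabsP[d d0 fd] hs'.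
have r0 : 0 < r by apply: le_lt_trans wr; exact: cabs_ge0.
(* Halfway between |w| and r: w and w + h stay in the disc of radius t, while t / r < 1 makes the
   remainders summable, with total at most K |h|^2. *)
pose t := (cabs w + r) / 2; have w0 := cabs_ge0 w.
have t0 : 0 < t by rewrite /t; lra.
have q1 : 0 <= t / r < 1.
  by rewrite divr_ge0 ?ltW // ltr_pdivrMr // mul1r /t; lra.
pose K := M * (2 * (1 - t / r) ^- 3) / t ^+ 2.
have K0 : 0 <= K.
  rewrite !mulr_ge0 ?invr_ge0 ?exprn_ge0 // ?(ltW t0) // subr_ge0 ltW //.
  by case/andP: q1.
have main h : cabs h < Num.min d (t - cabs w) ->
    cabs (f (w + h) - f w - h * s') <= K * cabs h ^+ 2.
  rewrite lt_min => /andP[hd ht].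
  have p1 : psum c (w + h) (f (w + h)) by apply: fd; rewrite addrC addrA addNr add0r.
  have p2 : psum c w (f w) by apply: fd; rewrite subrr cabs0.
  (* The shift by one matches N terms of the derived series with N + 1 terms of the original, whose
     constant term has derivative 0. *)
  have p1' : (fun N => series (fun n => c n * (w + h) ^+ n) N.+1) @ \oo --> f (w + h).
    exact: cvg_shiftS_complex p1.
  have p2' : (fun N => series (fun n => c n * w ^+ n) N.+1) @ \oo --> f w.
    exact: cvg_shiftS_complex p2.
  have hE : (fun N => series (fun n => c n * (w + h) ^+ n) N.+1 -
      series (fun n => c n * w ^+ n) N.+1
      - h * series (fun n => derseq c n * w ^+ n) N) @ \oo --> f (w + h) - f w - h * s'.
    exact: (cvgB_complex (cvgB_complex p1' p2') (cvgM_complex (@cvg_cst_complex _ _ _ h) hs')).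
  apply: (cabs_lim_le hE) => N.
  have -> : series (fun n => c n * (w + h) ^+ n) N.+1 - series (fun n => c n * w ^+ n) N.+1
     - h * series (fun n => derseq c n * w ^+ n) N =
     \sum_(n < N.+1) c n * ((w + h) ^+ n - w ^+ n - h * (n%:R * w ^+ n.-1)).
    rewrite /series /= !big_mkord.
    have -> : \sum_(n < N) derseq c n * w ^+ n = \sum_(n < N.+1) c n * (n%:R * w ^+ n.-1).
      rewrite [RHS]big_ord_recl /= mul0r mulr0 add0r; apply: eq_bigr => i _.
      by rewrite /derseq /bump /= add1n; ring.
    by rewrite mulr_sumr -!sumrB; apply: eq_bigr => i _; ring.
  apply: le_trans (cabs_sum _ _) _.
  have -> : K * cabs h ^+ 2 = (M * (cabs h ^+ 2 / t ^+ 2)) * (2 * (1 - t / r) ^- 3).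
    by rewrite /K; ring.
  have le1 := sqr_geo_bound N.+1 q1.
  have A0 : 0 <= M * (cabs h ^+ 2 / t ^+ 2).
    by rewrite !mulr_ge0 ?invr_ge0 ?exprn_ge0 ?cabs_ge0 // ltW.
  apply: le_trans (ler_wpM2l A0 le1); rewrite mulr_sumr; apply: ler_sum => n _.
  rewrite cabsM.
  have wt : cabs w <= t by rewrite /t; lra.
  have wht : cabs (w + h) <= t by have := cabsD w h; lra.
  have := exp_taylor n wt wht; rewrite -ler_pdivlMr ?exprn_gt0 // => hh.
  apply: le_trans (ler_wpM2l (cabs_ge0 _) hh) _.
  have -> : cabs (c n) * (n%:R ^+ 2 * cabs h ^+ 2 * t ^+ n / t ^+ 2) =
    (cabs (c n) * t ^+ n) * (n%:R ^+ 2 * (cabs h ^+ 2 / t ^+ 2)) by ring.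
  have -> : M * (cabs h ^+ 2 / t ^+ 2) * (n%:R ^+ 2 * (t / r) ^+ n) =
    (M * (t / r) ^+ n) * (n%:R ^+ 2 * (cabs h ^+ 2 / t ^+ 2)) by ring.
  rewrite ler_wpM2r ?mulr_ge0 ?invr_ge0 ?exprn_ge0 ?cabs_ge0 ?(ltW t0) //.
  have -> : t ^+ n = r ^+ n * (t / r) ^+ n by rewrite -exprMn mulrC divfK // gt_eqF.
  rewrite mulrA ler_wpM2r //; by case/andP: q1 => q0 _; rewrite exprn_ge0.
move=> e e0; exists (Num.min (Num.min d (t - cabs w)) (e / (K + 1))).
  rewrite !lt_min d0 /=; apply/andP; split; first by rewrite /t; lra.
  by rewrite divr_gt0 // ltr_wpDl.
move=> h; rewrite lt_min ltr_pdivlMr ?ltr_wpDl // => /andP[/main hh he].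
apply: le_trans hh _; have := cabs_ge0 h; rewrite expr2; nra.
Qed.

End PowerSeries.

(** * Analytic functions and their zeros *)

Section Analytic.
Variable R : realType.
Implicit Types (c : nat -> R[i]) (w z a h s : R[i]) (r : R) (f g : R[i] -> R[i]).
Implicit Types (D : set R[i]).

Definition analytic_at f a :=
  exists c, \forall z \near a, psum c (z - a) (f z).

Lemma analytic_at_bounded f a : analytic_at f a -> exists c r,
  [/\ 0 < r, cbounded c r & forall z, cabs (z - a) < r -> psum c (z - a) (f z)].
Proof.
move=> [c /nbhs_cabsP[d d0 hd]]; exists c, (d / 2).
have d20 : 0 < d / 2 by lra.
have dE : cabs (d / 2)%:C = d / 2 by rewrite cabs_real ger0_norm // ltW.
split=> // [|z zd]; last by apply: hd; lra.
(* Convergence at the single point a + d / 2 bounds the coefficients. *)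
have := hd (a + (d / 2)%:C); rewrite addrAC subrr add0r dE => /(_ _)/psum_bounded.
by rewrite dE; apply; lra.
Qed.

Lemma analytic_at_cderiv f a : analytic_at f a -> exists c r,
  [/\ 0 < r, cbounded c r & forall z, cabs (z - a) < r -> exists s,
    psum c (z - a) s /\ cderiv f z s].
Proof.
move=> /analytic_at_bounded[c [r [r0 cb hc]]]; exists (derseq c), (r / 2).
have r2 : 0 < r / 2 < r by apply/andP; split; lra.
have cb' := cbounded_derseq r2 cb.
split=> //; first by case/andP: r2.
move=> z zr; have [s hs] := psum_cvg cb' zr; exists s; split=> //.
have zr' : cabs (z - a) < r by case/andP: r2 => _; apply: lt_trans.
have fd : cderiv (fun w => f (w + a)) (z - a) s.
  apply: (psum_cderiv cb zr') hs; apply/nbhs_cabsP.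
  exists (r - cabs (z - a)); first by lra.
  move=> w hw; have := hc (w + a); rewrite addrK; apply.
  by have := cabsD (w - (z - a)) (z - a); rewrite subrK; lra.
have da : cderiv (fun w : R[i] => w - a) z 1.
  by have := cderivB (cderiv_id z) (cderiv_cst a z); rewrite subr0.
have := cderiv_comp da fd; rewrite mulr1; apply: cderiv_ext.
by apply: filterE => w; rewrite subrK.
Qed.

Lemma analytic_atB f g a : analytic_at f a -> analytic_at g a ->
  analytic_at (fun z => f z - g z) a.
Proof.
move=> [c hc] [c' hc']; exists (fun n => c n - c' n).
apply: filterS2 hc hc' => z h h'; rewrite /psum.
have -> : series (fun n => (c n - c' n) * (z - a) ^+ n) =
  fun N => series (fun n => c n * (z - a) ^+ n) N - series (fun n => c' n * (z - a) ^+ n) N.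
  apply/funext => N; rewrite /series /= -sumrB; apply: eq_bigr => i _.
  by rewrite mulrBl.
exact: cvgB_complex h h'.
Qed.

Lemma analytic_at_cst (k : R[i]) a : analytic_at (fun=> k) a.
Proof.
exists (fun n => if n is 0 then k else 0); apply: filterE => z.
apply: cvg_cst_cabs; exists 1%N => // N /= N1.
rewrite /series /= -(prednK N1) big_nat_recl //= expr0 mulr1 big1 ?addr0 // => i _.
by rewrite mul0r.
Qed.

(** Writing z = a + (z - a), the product adds a times the coefficients to the coefficients shifted
    by one. *)
Lemma analytic_atX f a : analytic_at f a -> analytic_at (fun z => z * f z) a.
Proof.
move=> [c hc]; exists (fun n => a * c n + (if n is m.+1 then c m else 0)).
apply: filterS hc => z h; rewrite /psum.
pose S N := series (fun n => c n * (z - a) ^+ n) N.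
suff hS : (fun N => (a * S N.+1 + (z - a) * S N)) @ \oo --> z * f z.
  apply/cvg_cabsP => e e0; have /cvg_cabsP/(_ _ e0)[N _ hN] := hS.
  exists N.+1 => // -[//|n] /= Nn; have := hN n Nn; rewrite /=.
  congr (cabs (_ - _) < _); rewrite /S /series /= mulr_sumr.
  rewrite [RHS](eq_bigr (fun i => a * (c i * (z - a) ^+ i) +
     (if i is m.+1 then c m else 0) * (z - a) ^+ i)); last first.
    by move=> i _; rewrite mulrDl mulrA.
  rewrite [RHS]big_split /=; congr (_ + _).
  rewrite [RHS]big_nat_recl // mul0r add0r mulr_sumr; apply: eq_bigr => i _.
  by rewrite exprS; ring.
have -> : z * f z = a * f z + (z - a) * f z by rewrite -mulrDl subrKC.
apply: cvgD_complex; apply: cvgM_complex; try exact: cvg_cst_complex.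
  exact: cvg_shiftS_complex h.
exact: h.
Qed.

(** Within half the radius the tail after the leading term is dominated by a geometric series of
    ratio at most 1/2, whence the factor 2 in the constant. *)
Lemma psum_lead c m r : 0 < r -> cbounded c r -> (forall k, (k < m)%N -> c k = 0) ->
  exists2 K : R, 0 <= K & forall w s, cabs w <= r / 2 -> psum c w s ->
    cabs (s - c m * w ^+ m) <= K * cabs w ^+ m.+1.
Proof.
move=> r0 [M M0 cM] c0; exists (M * 2 / r ^+ m.+1).
  by rewrite !mulr_ge0 ?invr_ge0 ?exprn_ge0 // ltW.
move=> w s wr hs; set v := cabs w.
have v0 : 0 <= v by exact: cabs_ge0.
have E : (fun N => series (fun n => c n * w ^+ n) (N + m.+1)%N - c m * w ^+ m) @ \oo -->
   s - c m * w ^+ m.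
  apply: cvgB_complex; last exact: cvg_cst_complex.
  apply/cvg_cabsP => e e0; have /cvg_cabsP/(_ _ e0)[N _ hN] := hs.
  by exists N => // n /= Nn; apply: hN; rewrite /= (leq_trans Nn) // leq_addr.
apply: (cabs_lim_le E) => N.
have -> : series (fun n => c n * w ^+ n) (N + m.+1)%N - c m * w ^+ m =
   \sum_(n < N) c (m.+1 + n)%N * w ^+ (m.+1 + n).
  rewrite /series /= (big_cat_nat _ (n := m.+1)) ?leq_addl //= big_nat_recr //=.
  rewrite big1_seq ?add0r; last first.
    by move=> i; rewrite mem_index_iota => /andP[_ /c0 ->]; rewrite mul0r.
  rewrite addrAC subrr add0r -{1}[m.+1]add0n big_addn addnK big_mkord.
  by apply: eq_bigr => i _; rewrite addnC.
apply: le_trans (cabs_sum _ _) _.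
have q1 : 0 <= v / r < 1.
  rewrite divr_ge0 ?(ltW r0) //= ltr_pdivrMr // mul1r; move: wr; rewrite -/v; lra.
have -> : M * 2 / r ^+ m.+1 * v ^+ m.+1 = M * (v / r) ^+ m.+1 * 2.
  by rewrite expr_div_n; ring.
have g2 : \sum_(n < N) (v / r) ^+ n <= 2.
  apply: le_trans (geo_bound N q1) _; rewrite -[leRHS]invrK lef_pV2 ?posrE //.
    have : v / r <= 1 / 2 by rewrite ler_pdivrMr //; move: wr; rewrite -/v; lra.
    by lra.
  by case/andP: q1; lra.
apply: le_trans (ler_wpM2l _ g2); last by case/andP: q1 => q0 _; rewrite mulr_ge0 ?exprn_ge0.
rewrite mulr_sumr; apply: ler_sum => n _; rewrite -mulrA -exprD cabsM cabsX -/v.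
have -> : v ^+ (m.+1 + n) = r ^+ (m.+1 + n) * (v / r) ^+ (m.+1 + n).
  by rewrite -exprMn mulrC divfK // gt_eqF.
by rewrite mulrA ler_wpM2r // exprn_ge0 //; case/andP: q1.
Qed.

(** If all coefficients before c_n vanish, a zero z different from a gives |c_n| <= K |z - a| by
    [psum_lead]; zeros arbitrarily close to a force c_n = 0. *)
Lemma isolated_zeros f a : analytic_at f a ->
  (forall d : R, 0 < d -> exists z, [/\ z != a, cabs (z - a) < d & f z = 0]) ->
  \forall z \near a, f z = 0.
Proof.
move=> /analytic_at_bounded[c [r [r0 cb hc]]] hz.
suff c0 n : c n = 0.
  apply/nbhs_cabsP; exists r => // z /hc h; apply: psum_unique h _.
  apply: cvg_cst_cabs; apply: filterE => N; rewrite /series /= big1 // => i _.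
  by rewrite c0 mul0r.
have [m] := ubnP n; elim: m n => // m IH n; rewrite ltnS => nm.
have ck k : (k < n)%N -> c k = 0 by move=> kn; apply: IH; rewrite (leq_trans kn).
have [K K0 hK] := psum_lead r0 cb ck.
apply/eqP; rewrite -cabs_eq0; apply/eqP/le_anti; rewrite cabs_ge0 andbT.
apply/ler_addgt0Pr => e e0; rewrite add0r.
have K1 : 0 < K + 1 by rewrite ltr_wpDl.
have d0 : 0 < Num.min (r / 2) (e / (K + 1)) by rewrite lt_min !divr_gt0.
have [z [za]] := hz _ d0; rewrite lt_min (ltr_pdivlMr _ _ K1) => /andP[zr ze] fz.
have := hc z; rewrite fz => /(_ _) h; have {}h : psum c (z - a) 0 by apply: h; lra.
have := hK _ _ (ltW zr) h; rewrite sub0r cabsN cabsM cabsX.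
have v0 : 0 < cabs (z - a) by rewrite cabs_gt0 subr_eq0.
rewrite exprS mulrA ler_pM2r ?exprn_gt0 // => h1.
by apply: le_trans h1 _; have := cabs_ge0 (z - a); nra.
Qed.

(** Let T be the supremum of the times up to which f vanishes. Zeros accumulate at time T, so f
    vanishes on a disc around that point, which would push the supremum further unless T = 1. *)
Lemma analytic_segment0 f a (d : R[i]) :
  (forall t : R, 0 <= t <= 1 -> analytic_at f (a + t%:C * d)) ->
  (\forall z \near a, f z = 0) -> f (a + d) = 0.
Proof.
move=> fan /nbhs_cabsP[e e0 fe].
have [->|dn0] := eqVneq d 0; first by rewrite addr0; apply: fe; rewrite subrr cabs0.
have D0 : 0 < cabs d by rewrite cabs_gt0.
pose P (t : R) := forall s : R, 0 <= s <= t -> f (a + s%:C * d) = 0.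
pose S := [set t : R | 0 <= t <= 1 /\ P t].
have S0 : S 0.
  split; first by rewrite lexx ler01.
  by move=> s /le_anti <-; rewrite mul0r addr0; apply: fe; rewrite subrr cabs0.
have Sub : ubound S 1 by move=> t [/andP[]].
have supS : has_sup S by split; [exists 0|exists 1].
pose T := sup S.
have T0 : 0 <= T by apply: ub_le_sup => //; case: supS.
have T1 : T <= 1 by apply: ge_sup => //; exists 0.
have below (s : R) : 0 <= s < T -> f (a + s%:C * d) = 0.
  move=> /andP[s0 sT]; have [t [_ Pt] st] := sup_gt supS.1 sT.
  by apply: Pt; rewrite s0 ltW.
suff TE : T = 1 /\ f (a + T%:C * d) = 0 by case: TE => -> ; rewrite mul1r.
have zdist (s t : R) : cabs (a + s%:C * d - (a + t%:C * d)) = `|s - t| * cabs d.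
  rewrite -cabs_real -cabsM rmorphB; congr cabs; ring.
have Tpos : 0 < T.
  have m0 : 0 < Num.min 1 (e / cabs d / 2) by rewrite lt_min ltr01 !divr_gt0.
  apply: (lt_le_trans m0); apply: ub_le_sup; first by case: supS.
  split; first by rewrite (ltW m0) ge_min lexx.
  move=> s /andP[s0]; rewrite le_min => /andP[_ s1].
  apply: fe; rewrite addrAC subrr add0r cabsM cabs_real ger0_norm //.
  rewrite -ltr_pdivlMr //; apply: le_lt_trans s1 _.
  by rewrite ltr_pdivrMr // ltr_pMr ?divr_gt0 // ltr1n.
have nearT : \forall z \near (a + T%:C * d), f z = 0.
  apply: isolated_zeros; first by apply: fan; rewrite T0 T1.
  (* A time before T, hence a zero of f, within distance x of the point at time T; the bound T / 2
     keeps it nonnegative. *)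
  move=> x x0; pose s := Num.max (T / 2) (T - x / cabs d / 2).
  have y0 : 0 < x / cabs d / 2 by rewrite !divr_gt0.
  have [s1 s2] : T / 2 <= s /\ T - x / cabs d / 2 <= s.
    by rewrite /s !le_max !lexx orbT.
  have sT : s < T by rewrite /s gt_max; apply/andP; split; lra.
  exists (a + s%:C * d); split.
  - by rewrite -subr_eq0 -cabs_eq0 zdist mulf_neq0 ?gt_eqF // normr_gt0 subr_eq0 lt_eqF.
  - rewrite zdist ltr0_norm ?subr_lt0 // -ltr_pdivlMr // opprB; lra.
  - by apply: below; rewrite sT andbT; lra.
move/nbhs_cabsP : nearT => [x x0 hx].
have fT : f (a + T%:C * d) = 0 by apply: hx; rewrite subrr cabs0.
split=> //; apply/eqP; rewrite eq_le T1 /= leNgt; apply/negP => Tlt.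
pose t := Num.min 1 (T + x / cabs d / 2).
have y0 : 0 < x / cabs d / 2 by rewrite !divr_gt0.
have tT : T < t by rewrite /t lt_min Tlt /= ltrDl.
have [t1 t2] : t <= 1 /\ t <= T + x / cabs d / 2 by rewrite /t !ge_min !lexx orbT.
have : t <= T; last by rewrite leNgt tT.
apply: ub_le_sup; first by case: supS.
split; first by rewrite t1 andbT; lra.
move=> s /andP[s0 st]; case: (ltrP s T) => sT; first by apply: below; rewrite s0.
apply: hx; rewrite zdist ger0_norm ?subr_ge0 // -ltr_pdivlMr //; lra.
Qed.

Lemma cderiv_unique f z s s' : cderiv f z s -> cderiv f z s' -> s = s'.
Proof. by move=> /is_derive_cderivP[_ <-] /is_derive_cderivP[_ <-]. Qed.

(** Differential equations are extended from the disc to D by the identity theorem, which requires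
    the derivative itself to be an analytic function. *)
Lemma analytic_derivative D f : (forall a, D a -> analytic_at f a) ->
  exists g : R[i] -> R[i], forall a, D a -> analytic_at g a /\ cderiv f a (g a).
Proof.
move=> fan; have [g hg] : {g : R[i] -> R[i] | forall a s, cderiv f a s -> g a = s}.
  exists (fun z => 'D_1 f z) => a s /is_derive_cderivP[_]; exact.
exists g => a /fan /analytic_at_cderiv[c [r [r0 cb hc]]]; split.
  by exists c; apply/nbhs_cabsP; exists r => // z /hc[s [hs /hg ->]].
have [s [_ ds]] : exists s, psum c (a - a) s /\ cderiv f a s.
  by apply: hc; rewrite subrr cabs0.
by rewrite (hg _ _ ds).
Qed.

End Analytic.

(** * The KZ equation for polylogarithms *)

Section Insertions.

(* The terms of the shuffle product of x and v other than v x. *)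
Fixpoint xins (v : word) : seq word :=
  if v is l :: v' then (lx :: v) :: map (cons l) (xins v') else [::].

Lemma shuffle_xE (v : word) k :
  shuffle [:: lx] (v ++ nseq k lx) =
  map (cat^~ (nseq k lx)) (xins v) ++ nseq k.+1 (v ++ nseq k.+1 lx).
Proof.
have cons_r l u : shuffle [:: lx] (l :: u) =
    (lx :: l :: u) :: map (cons l) (shuffle [:: lx] u) by [].
elim: v => [|l v IH].
  by elim: k => [|k IHk] //; rewrite [nseq k.+1 lx]/= cons_r IHk map_cat map_nseq.
rewrite cat_cons cons_r IH map_cat map_nseq /= -!map_comp.
by congr (_ :: (_ ++ _ :: _)); apply: eq_map.
Qed.

(* Words ending with y, and the empty word: the basis of h^1. *)
Definition in_h1 (w : word) := last ly w == ly.

Lemma in_h1_tail l w : in_h1 (l :: w) -> in_h1 w.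
Proof. by case: w. Qed.

(** An inserted x always precedes some letter of v, so the last letter is unchanged. This keeps the
    inductions on the number of trailing letters x inside h^1, and nonemptiness makes the limits at
    0 of the inserted terms vanish. *)
Lemma xins_h1 v v' : in_h1 v -> v' \in xins v -> in_h1 v' /\ v' <> [::].
Proof.
elim: v v' => [//|l v IH] v' lv; rewrite inE => /orP[/eqP -> //|].
move=> /mapP[u uv ->]; have [] := IH _ (in_h1_tail lv) uv.
by case: u uv.
Qed.

Lemma in_h1_index w : in_h1 w ->
  exists2 ks, all (leq 1) ks & w = index_word ks.
Proof.
elim: w => [|l w IH] lw; first by exists [::].
have [ks ks1 wE] := IH (in_h1_tail lw); case: l lw => lw; last first.
  by exists (1%N :: ks) => //=; rewrite wE.
case: ks ks1 wE => [|[//|k] ks] /= ks1 wE; first by rewrite wE in lw.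
by exists (k.+2 :: ks) => //; rewrite wE.
Qed.

Lemma word_h1_split (w : word) : exists v k, in_h1 v /\ w = v ++ nseq k lx.
Proof.
elim/last_ind: w => [|w [] [v [k [hv ->]]]]; first by exists [::], 0%N.
  exists v, k.+1; split=> //; rewrite -cats1 -catA; congr (_ ++ _).
  by rewrite -[[:: lx]]/(nseq 1 lx) -nseqD addn1.
by exists (rcons (v ++ nseq k lx) ly), 0%N; rewrite /in_h1 last_rcons cats0.
Qed.

End Insertions.

(** * The domain D *)

Section Domains.
Variable R : realType.
Implicit Types z : R[i].

Lemma domD_Im z : complex.Im z != 0 -> domD z.
Proof. by move=> /eqP h []. Qed.

Lemma domDP z : domD z <-> complex.Im z != 0 \/ 0 < complex.Re z < 1.
Proof.
split=> [h|[|/andP[h1 h2]]]; [|exact: domD_Im|].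
  have [i0|] := eqVneq (complex.Im z) 0; [right|by left].
  rewrite !ltNge; apply/andP; split; apply/negP => hz; apply: h; split=> //.
    by left.
  by right.
by move=> [_ []]; lra.
Qed.

Lemma domD_neq0 z : domD z -> z != 0.
Proof. by move=> /domDP h; apply/eqP => e; move: h; rewrite e /= eqxx ltxx; case. Qed.

Lemma domD_neq1 z : domD z -> 1 - z != 0.
Proof.
move=> /domDP h; rewrite subr_eq0; apply/eqP => e.
by move: h; rewrite -e /= eqxx ltxx andbF; case.
Qed.

Lemma domD_slit z : domD z -> slit z.
Proof. by move=> h [h1 h2]; apply: h; split=> //; left. Qed.

Lemma domD_near z : domD z -> \forall w \near z, domD w.
Proof.
move=> /domDP[i0|/andP[h1 h2]]; apply/nbhs_cabsP.
  exists `|complex.Im z|; first by rewrite normr_gt0.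
  move=> w hw; apply/domDP; left; apply: contraTneq hw => w0.
  by rewrite -leNgt; have := Im_le_cabs (w - z); rewrite ImD ImN w0 add0r normrN.
exists (Num.min (complex.Re z) (1 - complex.Re z)).
  by rewrite lt_min h1 subr_gt0.
move=> w; rewrite lt_min => /andP[w1 w2]; apply/domDP; right.
have := Re_le_cabs (w - z); rewrite ReD ReN ler_norml => /andP[w3 w4].
by apply/andP; split; lra.
Qed.

Lemma domD_star z (t : R) : domD z -> 0 <= t <= 1 ->
  domD (2^-1 + t%:C * (z - 2^-1)).
Proof.
move=> /domDP zD /andP[t0 t1]; apply/domDP.
have hE : (2^-1 : R[i]) = (2^-1 : R)%:C by rewrite fmorphV rmorph_nat.
have ReE : complex.Re (2^-1 + t%:C * (z - 2^-1)) = 2^-1 + t * (complex.Re z - 2^-1).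
  by rewrite hE ReD; case: (z) => x y /=; ring.
have ImE : complex.Im (2^-1 + t%:C * (z - 2^-1)) = t * complex.Im z.
  by rewrite hE ImD; case: (z) => x y /=; ring.
rewrite ReE ImE.
have [->|tn0] := eqVneq t 0; first by right; rewrite mul0r addr0; apply/andP; split; lra.
case: zD => [i0|/andP[h1 h2]]; first by left; rewrite mulf_neq0.
by right; apply/andP; split; nra.
Qed.

End Domains.

Section PolylogarithmKZ.
Variable R : realType.
Variable Li : word -> R[i] -> R[i].
Hypothesis hLi : polylogarithms Li.
Implicit Types (z : R[i]) (w v : word).

(** The Taylor coefficients at 0 of the polylogarithm. At n = 0 the convention 0^-1 = 0 gives the
    value 0 whenever the first exponent is positive; the empty index list gives the constant series
    1. *)
Definition pcoef (ks : seq nat) (n : nat) : R[i] :=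
  if ks is k :: ks' then n%:R ^- k * mzsum R ks' n else (n == 0%N)%:R.

Arguments pcoef : simpl never.

Lemma pcoef0 k ks : pcoef (k.+1 :: ks) 0 = 0.
Proof. by rewrite /pcoef expr0n /= invr0 mul0r. Qed.

Lemma mzsumE ks N : all (leq 1) ks -> mzsum R ks N.+1 = \sum_(n < N.+1) pcoef ks n.
Proof.
case: ks => [|[//|k] ks] /= h.
  by rewrite /pcoef big_ord_recl /= big1 ?addr0.
rewrite -(big_mkord xpredT (pcoef (k.+1 :: ks))) [RHS]big_ltn // pcoef0 add0r.
by [].
Qed.

Lemma polylog_sumE ks z N : all (leq 1) ks ->
  polylog_sum ks z N.+1 = series (fun n => pcoef ks n * z ^+ n) N.+1.
Proof.
rewrite /series [RHS]/=; case: ks => [|[//|k] ks] h.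
  rewrite /pcoef /= big_ltn // expr0 mulr1 big_nat big1 ?addr0 // => i /andP[i0 _].
  by rewrite gtn_eqF // mul0r.
rewrite [LHS]/= [RHS]big_ltn // pcoef0 mul0r add0r; apply: eq_bigr => i _.
by rewrite /pcoef [_ / _]mulrC mulrAC.
Qed.

Lemma Li_psum ks z : all (leq 1) ks -> domD z -> cabs z < 1 ->
  psum (pcoef ks) z (Li (index_word ks) z).
Proof.
move=> hks zD z1; have z1' : `|z| < 1 by rewrite normE -[1](rmorph1 (real_complex R)) ltcR.
have /cvg_cabsP h := Li_series hLi hks zD z1'.
apply/cvg_cabsP => e e0; have [N _ hN] := h _ e0.
exists N.+1 => // -[//|n] /= Nn; rewrite -polylog_sumE //.
by apply: hN; rewrite /= ltnW.
Qed.

(** No estimate of the nested sums is made: the series is known to converge at the point i r, which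
    lies in D, and a convergent series has bounded terms. *)
Lemma pcoef_bounded ks (r : R) : all (leq 1) ks -> 0 < r < 1 -> cbounded (pcoef ks) r.
Proof.
move=> hks /andP[r0 r1]; pose z : R[i] := 0 +i* r.
have zE : cabs z = r by rewrite cabsE /= expr0n add0r sqrtr_sqr gtr0_norm.
have := @Li_psum ks z hks; rewrite zE => /(_ _ r1) h.
rewrite -zE; apply: psum_bounded; apply: h.
by apply: domD_Im; rewrite gt_eqF.
Qed.

Lemma Li_disc_cderiv ks z : all (leq 1) ks -> domD z -> cabs z < 1 ->
  exists2 s, psum (derseq (pcoef ks)) z s & cderiv (Li (index_word ks)) z s.
Proof.
move=> hks zD z1; have z0 := cabs_ge0 z.
(* |z| < r < r' < 1: the coefficients are bounded at r', those of the derived series at r, and z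
   lies inside. *)
pose r := (cabs z + 1) / 2; pose r' := (r + 1) / 2.
have r01 : 0 < r < r' by apply/andP; split; rewrite /r' /r; lra.
have r'1 : 0 < r' < 1 by apply/andP; split; rewrite /r' /r; lra.
have zr : cabs z < r by rewrite /r; lra.
have cb := pcoef_bounded hks r'1.
have [s hs] := psum_cvg (cbounded_derseq r01 cb) zr.
exists s => //; apply: (psum_cderiv cb) hs; first by case/andP: r01 => _; apply: lt_trans.
have hd := domD_near zD; move/nbhs_cabsP: hd => [d d0 hd].
apply/nbhs_cabsP; exists (Num.min d (1 - cabs z)); first by rewrite lt_min d0 subr_gt0.
move=> w; rewrite lt_min => /andP[/hd wD wz]; apply: Li_psum => //.
by have := cabsD (w - z) z; rewrite subrK; lra.
Qed.

(** The operator z d/dz multiplies the n-th coefficient by n, which lowers the first exponent by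
    one. *)
Lemma Li_disc_x k ks z s : all (leq 1) (k.+1 :: ks) -> domD z -> cabs z < 1 ->
  psum (derseq (pcoef (k.+2 :: ks))) z s -> z * s = Li (index_word (k.+1 :: ks)) z.
Proof.
move=> hks zD z1 hs; apply: psum_unique _ (Li_psum hks zD z1).
apply/cvg_cabsP => e e0.
have hz : (fun N => z * series (fun n => derseq (pcoef (k.+2 :: ks)) n * z ^+ n) N)
   @ \oo --> z * s by apply: cvgM_complex hs; exact: cvg_cst_complex.
have /cvg_cabsP/(_ _ e0)[N _ hN] := hz.
exists N.+1 => // -[//|n] /= Nn; have := hN n Nn.
rewrite /=; congr (cabs (_ - _) < _); rewrite /series /= mulr_sumr.
rewrite [RHS]big_nat_recl // pcoef0 mul0r add0r; apply: eq_bigr => i _.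
rewrite /derseq /pcoef [z ^+ i.+1]exprS [_ ^+ k.+2]exprS invfM.
have : (i.+1%:R : R[i]) != 0 by rewrite pnatr_eq0.
by move: (i.+1%:R : R[i]) => x x0; field; rewrite x0 expf_neq0.
Qed.

(** The derived coefficients b_n are the partial sums of the coefficients for [ks], so
    multiplication by 1 - z telescopes. The boundary term z b_N z^N tends to 0, because b_N z^N is
    the general term of a convergent series. *)
Lemma Li_disc_y ks z s : all (leq 1) ks -> domD z -> cabs z < 1 ->
  psum (derseq (pcoef (1%N :: ks))) z s -> (1 - z) * s = Li (index_word ks) z.
Proof.
move=> hks zD z1 hs; have hA := Li_psum hks zD z1.
pose b := derseq (pcoef (1%N :: ks)).
have bE n : b n = \sum_(m < n.+1) pcoef ks m.
  rewrite /b /derseq /pcoef expr1 mulrA mulfV ?pnatr_eq0 // mul1r.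
  exact: mzsumE.
have b0 := series_term_cvg0 hs.
have h1 : (fun N => (1 - z) * series (fun n => b n * z ^+ n) N.+1) @ \oo --> (1 - z) * s.
  by apply: cvgM_complex; [exact: cvg_cst_complex|exact: cvg_shiftS_complex hs].
have h2 : (fun N => series (fun n => pcoef ks n * z ^+ n) N.+1 - z * (b N * z ^+ N)) @ \oo -->
    Li (index_word ks) z - z * 0.
  apply: cvgB_complex; first exact: cvg_shiftS_complex hA.
  by apply: cvgM_complex b0; exact: cvg_cst_complex.
rewrite mulr0 subr0 in h2; apply: cvg_unique_complex h1 _.
suff -> : (fun N => (1 - z) * series (fun n => b n * z ^+ n) N.+1) =
   (fun N => series (fun n => pcoef ks n * z ^+ n) N.+1 - z * (b N * z ^+ N)) by [].
apply/funext; elim=> [|N IH].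
  rewrite /series /= !big_nat1 expr0 !mulr1 (bE 0%N) big_ord_recr big_ord0 /=; ring.
rewrite /series /= big_nat_recr //= mulrDr; rewrite /series /= in IH; rewrite IH.
rewrite [X in _ = X - _]big_nat_recr //= (bE N.+1) big_ord_recr /= -bE [z ^+ N.+1]exprS.
ring.
Qed.

Definition kz_form l z : R[i] := if l is lx then z^-1 else (1 - z)^-1.

Lemma Li_analytic_at w z : in_h1 w -> domD z -> analytic_at (Li w) z.
Proof. by move=> /in_h1_index[ks hks ->] zD; exact: (Li_analytic hLi hks zD). Qed.

Lemma identity_domD (f : R[i] -> R[i]) : (forall z, domD z -> analytic_at f z) ->
  (forall z, domD z -> cabs z < 1 -> f z = 0) -> forall z, domD z -> f z = 0.
Proof.
move=> fan f0 z zD; rewrite -[z](subrKC 2^-1).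
have hc : cabs (2^-1 : R[i]) = 2^-1 by rewrite cabsV cabs_nat.
have hD : domD (2^-1 : R[i]).
  have := domD_star zD; move=> /(_ 0); rewrite lexx ler01 mul0r addr0; exact.
apply: analytic_segment0 => [t t01|]; first by apply: fan; exact: domD_star.
have /nbhs_cabsP[d d0 hd] := domD_near hD.
apply/nbhs_cabsP; exists (Num.min d (1/2)); first by rewrite lt_min d0; lra.
move=> w; rewrite lt_min => /andP[/hd wD w2]; apply: f0 => //.
have := cabsD (w - 2^-1) 2^-1; rewrite subrK hc; lra.
Qed.

(** The series gives the value 1 in the unit disc only; the rest of D is reached by the identity
    theorem. *)
Lemma Li_nil z : domD z -> Li [::] z = 1.
Proof.
move=> zD; apply/eqP; rewrite -subr_eq0; apply/eqP; move: z zD.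
apply: identity_domD => [z zD|z zD z1].
  by apply: analytic_atB; [exact: Li_analytic_at|exact: analytic_at_cst].
apply/eqP; rewrite subr_eq0; apply/eqP.
have := @Li_psum [::] z isT zD z1; move/psum_unique; apply.
apply: cvg_cst_cabs; exists 1%N => // -[//|N] _ /=.
by rewrite -(@polylog_sumE [::]).
Qed.

Lemma Li_h1_cderiv l w z : in_h1 (l :: w) -> domD z ->
  cderiv (Li (l :: w)) z (kz_form l z * Li w z).
Proof.
move=> lw; have hw := in_h1_tail lw.
(* The equation is cleared of its denominator, so that both sides are visibly analytic on D and
   their difference can be continued from the disc. *)
pose p (z : R[i]) := if l is lx then z else 1 - z.
have [g gP] := analytic_derivative (fun z => @Li_analytic_at _ z lw).
have key : forall z, domD z -> p z * g z - Li w z = 0.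
  apply: identity_domD => [{}z zD|{}z zD z1].
    apply: analytic_atB; last exact: Li_analytic_at.
    have [han _] := gP z zD; rewrite /p; case: (l).
      exact: (analytic_atX han).
    have -> : (fun z => (1 - z) * g z) = (fun z => g z - z * g z).
      by apply/funext => u; rewrite mulrBl mul1r.
    exact: (analytic_atB han (analytic_atX han)).
  apply/eqP; rewrite subr_eq0; apply/eqP.
  have [_ dg] := gP z zD.
  have [ks hks wE] := in_h1_index hw; rewrite wE; rewrite wE in dg.
  case: (l) lw @p dg => lw p dg; last first.
    have [s hs ds] := @Li_disc_cderiv (1%N :: ks) z hks zD z1.
    by rewrite (cderiv_unique dg ds); exact: Li_disc_y hs.
  case: ks hks wE dg => [|[//|k] ks] hks wE dg; first by rewrite wE in lw.
  have [s hs ds] := @Li_disc_cderiv (k.+2 :: ks) z hks zD z1.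
  by rewrite (cderiv_unique dg ds); exact: Li_disc_x hs.
move=> zD; have [_] := gP z zD.
suff -> : g z = kz_form l z * Li w z by [].
have /eqP := key z zD; rewrite subr_eq0 => /eqP <-; rewrite /kz_form /p.
by case: (l); rewrite mulKf //; [exact: domD_neq0|exact: domD_neq1].
Qed.

Lemma Li_xrec v k z : domD z ->
  k.+1%:R * Li (v ++ nseq k.+1 lx) z =
  clog z * Li (v ++ nseq k lx) z - \sum_(v' <- xins v) Li (v' ++ nseq k lx) z.
Proof.
move=> zD; have := Li_shuffle hLi [:: lx] (v ++ nseq k lx) zD.
rewrite Li_x // shuffle_xE big_cat big_map big_nseq iter_addr_0 => <-.
by rewrite [RHS]addrC addKr mulr_natl.
Qed.

Definition dLi w z : R[i] := if w is l :: w' then kz_form l z * Li w' z else 0.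

Lemma Li_cderiv w z : domD z -> cderiv (Li w) z (dLi w z).
Proof.
have [v [k [hv ->]]] := word_h1_split w; elim: k v hv z => [|k IH] v hv z zD.
  rewrite cats0; case: v hv => [|l v] hv; last exact: Li_h1_cderiv.
  apply: cderiv_ext (cderiv_cst 1 z).
  by apply: filterS (domD_near zD) => u uD; rewrite Li_nil.
have k0 : (k.+1%:R : R[i]) != 0 by rewrite pnatr_eq0.
pose f u := k.+1%:R^-1 * (clog u * Li (v ++ nseq k lx) u -
   \sum_(v' <- xins v) Li (v' ++ nseq k lx) u).
pose f' := k.+1%:R^-1 * (z^-1 * Li (v ++ nseq k lx) z + clog z * dLi (v ++ nseq k lx) z
   - \sum_(v' <- xins v | v' \in xins v) dLi (v' ++ nseq k lx) z).
have df : cderiv f z f'.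
  apply: cderivZ; apply: cderivB.
    exact: (cderivM (cderiv_clog (domD_slit zD)) (IH v hv z zD)).
  have -> : (fun u => \sum_(v' <- xins v) Li (v' ++ nseq k lx) u) =
      (fun u => \sum_(v' <- xins v | v' \in xins v) Li (v' ++ nseq k lx) u).
    by apply/funext => u; rewrite big_seq.
  apply: (@cderiv_sum _ _ _ _ (fun v' => Li (v' ++ nseq k lx))
    z (fun v' => dLi (v' ++ nseq k lx) z)) => v'.
  by move=> /(xins_h1 hv)[hv' _]; exact: IH.
have -> : dLi (v ++ nseq k.+1 lx) z = f'.
  (* For empty v there is no insertion, and the recursion for powers of the logarithm is used.
     Otherwise the insertion of x in front of v cancels the derivative of log z, and the first
     letter factors out of all remaining terms. *)
  rewrite /f' -big_seq; case: v hv {f f' df} => [|l v] hv.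
    rewrite big_nil subr0; case: k {IH} k0 => [|k] k0.
      by rewrite /= mulr0 addr0 invr1 mul1r.
    have := Li_xrec [::] k zD; rewrite /= big_nil subr0 => h.
    rewrite /= (mulrCA (clog z)) -h.
    move: k0; rewrite -[k.+2%:R]natr1; move: (k.+1%:R : R[i]) => x x0.
    by field; rewrite x0 domD_neq0.
  rewrite /= big_cons big_map /= -mulr_sumr.
  have := Li_xrec v k zD => /(canRL (mulKf k0)) ->.
  rewrite /= /kz_form; ring.
apply: cderiv_ext df; apply: filterS (domD_near zD) => u uD.
by rewrite /f -Li_xrec // mulKf.
Qed.

End PolylogarithmKZ.

(** * Substitution and exponential of formal series *)

Section FpsAlgebra.
Variable K : comNzRingType.
Implicit Types (A B C F G H : fps K) (w v : word) (n N : nat).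

(** The left quotient by a letter: F is its constant term plus X [lquot lx F] plus Y
    [lquot ly F]. *)
Definition lquot (l : letter) F : fps K := fun w => F (l :: w).

Lemma fps_sumE I (r : seq I) (P : pred I) (F : I -> fps K) w :
  (\sum_(i <- r | P i) F i) w = \sum_(i <- r | P i) F i w.
Proof. by apply: (big_morph (fun G : fps K => G w)). Qed.

Lemma fmul_nil F G : (F * G) [::] = F [::] * G [::].
Proof. by rewrite /GRing.mul /= /fmul big_ord_recl big_ord0 addr0. Qed.

Lemma fmul_cons F G l w : (F * G) (l :: w) = F [::] * G (l :: w) + (lquot l F * G) w.
Proof. by rewrite {1}/GRing.mul /= /fmul big_ord_recl. Qed.

Lemma lquotM F G l : lquot l (F * G) = F [::] *: lquot l G + lquot l F * G.
Proof. by apply/funext => w; rewrite /lquot fmul_cons. Qed.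

(** Congruence modulo the n-th power of the ideal of series without constant term. Multiplication by
    an element of that ideal gains one length, which drives the inductions below. *)
Definition agree n F G := forall w, (size w < n)%N -> F w = G w.

Lemma agreeMr n A F G : A [::] = 0 -> agree n F G -> agree n.+1 (A * F) (A * G).
Proof.
move=> A0 FG [|l w]; rewrite ltnS => wn; first by rewrite !fmul_nil A0 !mul0r.
rewrite !fmul_cons A0 !mul0r !add0r; apply: eq_bigr => i _; congr (_ * _).
by apply: FG; rewrite size_drop; apply: leq_ltn_trans wn; exact: leq_subr.
Qed.

Lemma expr_low A n w : A [::] = 0 -> (size w < n)%N -> (A ^+ n) w = 0.
Proof.
move=> A0; elim: n w => // n IH w wn; rewrite exprS.
have -> : (0 : K) = (A * 0) w by rewrite mulr0.
by apply: (@agreeMr n) wn => // v vn; exact: IH.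
Qed.

Section Substitution.
Variables (A B : fps K).
Hypotheses (A0 : A [::] = 0) (B0 : B [::] = 0).

Definition fletter (l : letter) := if l is lx then A else B.

Lemma fletter0 l : fletter l [::] = 0. Proof. by case: l. Qed.

Lemma fword_cons l w : fword A B (l :: w) = fletter l * fword A B w.
Proof. by rewrite /fword big_cons. Qed.

Lemma fword_low w v : (size v < size w)%N -> fword A B w v = 0.
Proof.
elim: w v => // l w IH v vw; rewrite fword_cons.
have -> : (0 : K) = (fletter l * 0) v by rewrite mulr0.
by apply: (@agreeMr (size w)) vw; [exact: fletter0|move=> u uw; exact: IH].
Qed.

(** A finite sum in the algebra, with a cutoff that does not depend on the coefficient examined, so
    the ring laws apply to it directly. *)
Definition ftrunc N F : fps K :=
  \sum_(n < N) \sum_(w : n.-tuple letter) F w *: fword A B w.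

Lemma ftruncE N F v : ftrunc N F v =
  \sum_(n < N) \sum_(w : n.-tuple letter) F w * fword A B w v.
Proof. by rewrite /ftrunc fps_sumE; apply: eq_bigr => n _; rewrite fps_sumE. Qed.

Lemma fsubst_trunc N F : agree N (fsubst A B F) (ftrunc N F).
Proof.
move=> v vN; rewrite ftruncE /fsubst.
rewrite (big_ord_widen N (fun n => \sum_(w : n.-tuple letter) F w * fword A B w v)) //.
rewrite big_mkcond; apply: eq_bigr => n _; case: ltnP => // vn.
by rewrite big1 // => w _; rewrite fword_low ?mulr0 // size_tuple.
Qed.

Lemma sum_letter (V : nmodType) (f : letter -> V) : \sum_(l : letter) f l = f lx + f ly.
Proof.
rewrite (reindex_onto bool_to_letter letter_to_bool) /=; last by case.
rewrite big_mkcond big_bool /= addrC //.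
Qed.

Lemma sum_tuple_cons (V : nmodType) n (f : word -> V) :
  \sum_(w : n.+1.-tuple letter) f w =
  \sum_(l : letter) \sum_(w : n.-tuple letter) f (l :: w).
Proof.
rewrite pair_big /=.
rewrite (reindex (fun p : letter * n.-tuple letter => [tuple of p.1 :: p.2])) //=.
exists (fun w : n.+1.-tuple letter => (thead w, [tuple of behead w])) => [[l w] _|w _].
  by congr (_, _); apply: val_inj.
by rewrite /=; case/tupleP: w => l w; apply: val_inj.
Qed.

(** Words are sorted by their first letter. The recursion determines [fsubst] by induction on
    length, since A and B raise lengths. *)
Lemma fsubst_rec F : fsubst A B F =
  F [::] *: 1 + A * fsubst A B (lquot lx F) + B * fsubst A B (lquot ly F).
Proof.
apply/funext => v.
have -> : fsubst A B F v = F [::] * (1 : fps K) v +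
   (A * ftrunc (size v) (lquot lx F)) v + (B * ftrunc (size v) (lquot ly F)) v.
  rewrite /fsubst big_ord_recl -addrA; congr (_ + _).
    rewrite (bigD1 [tuple]) //= big1 ?addr0; last by move=> w /eqP[]; rewrite [w]tuple0.
    by rewrite /fword big_nil.
  rewrite /ftrunc !mulr_sumr !fps_sumE -big_split /=; apply: eq_bigr => n _.
  rewrite (sum_tuple_cons _ (fun w => F w * fword A B w v)) sum_letter.
  by congr (_ + _); rewrite mulr_sumr fps_sumE; apply: eq_bigr => w _;
    rewrite fword_cons -scalerAr.
by congr (_ + _ + _); apply: (@agreeMr (size v)) => // w wn; rewrite (fsubst_trunc _ wn).
Qed.

Lemma fsubstD F G : fsubst A B (F + G) = fsubst A B F + fsubst A B G.
Proof.
apply/funext => v; transitivity (fsubst A B F v + fsubst A B G v) => //.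
rewrite /fsubst -big_split; apply: eq_bigr => n _.
by rewrite /= -big_split; apply: eq_bigr => w _; rewrite /= -mulrDl.
Qed.

Lemma fsubstZ (c : K) F : fsubst A B (c *: F) = c *: fsubst A B F.
Proof.
apply/funext => v; transitivity (c * fsubst A B F v) => //.
rewrite /fsubst mulr_sumr; apply: eq_bigr => n _.
by rewrite mulr_sumr; apply: eq_bigr => w _; rewrite mulrA.
Qed.

Lemma fsubst0 : fsubst A B 0 = 0.
Proof.
apply/funext => v; rewrite /fsubst big1 // => n _; rewrite big1 // => w _.
exact: mul0r.
Qed.

Lemma fsubst1 : fsubst A B 1 = 1.
Proof.
rewrite fsubst_rec.
have q0 l : lquot l 1 = 0 :> fps K by apply/funext => w.
rewrite !q0 fsubst0 !mulr0 !addr0.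
by rewrite [(1 : fps K) [::]](_ : _ = 1) ?scale1r.
Qed.

Lemma fsubst_sum I (r : seq I) (P : pred I) (F : I -> fps K) :
  fsubst A B (\sum_(i <- r | P i) F i) = \sum_(i <- r | P i) fsubst A B (F i).
Proof. by apply: big_morph => [F' G'|]; [exact: fsubstD|exact: fsubst0]. Qed.

(** As functions of F both sides obey the same recursion, by [lquotM]; the factors A and B provide
    the step from length n to n + 1. *)
Lemma fsubstM F G : fsubst A B (F * G) = fsubst A B F * fsubst A B G.
Proof.
suff h n : forall F G, agree n (fsubst A B (F * G)) (fsubst A B F * fsubst A B G).
  by apply/funext => v; apply: (h (size v).+1).
elim: n => // n IH {}F {}G.
have -> : fsubst A B (F * G) = F [::] *: fsubst A B G +
   A * fsubst A B (lquot lx F * G) + B * fsubst A B (lquot ly F * G).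
  rewrite fsubst_rec !lquotM !fsubstD !fsubstZ fmul_nil [in RHS](fsubst_rec G).
  rewrite !scalerDr scalerA !mulrDr -!scalerAr -!addrA; congr (_ + (_ + _)).
  by rewrite addrCA.
rewrite [in X in agree _ _ X](fsubst_rec F) !mulrDl -scalerAl mul1r -!mulrA => w wn.
by congr (_ + _ + _); apply: (@agreeMr n).
Qed.

Lemma fsubstX : fsubst A B (fX K) = A.
Proof.
rewrite fsubst_rec.
have -> : lquot lx (fX K) = 1 by apply/funext => w; rewrite /lquot /fX eqseq_cons.
have -> : lquot ly (fX K) = 0 by apply/funext.
by rewrite fsubst1 fsubst0 mulr1 mulr0 addr0 scale0r add0r.
Qed.

Lemma fsubstY : fsubst A B (fY K) = B.
Proof.
rewrite fsubst_rec.
have -> : lquot ly (fY K) = 1 by apply/funext => w; rewrite /lquot /fY eqseq_cons.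
have -> : lquot lx (fY K) = 0 by apply/funext.
by rewrite fsubst1 fsubst0 mulr1 mulr0 addr0 scale0r add0r.
Qed.

Lemma fsubstXn F n : fsubst A B (F ^+ n) = fsubst A B F ^+ n.
Proof. by elim: n => [|n IH]; rewrite ?expr0 ?fsubst1 // !exprS fsubstM IH. Qed.

Lemma agree_fsubst n F G : agree n F G -> agree n (fsubst A B F) (fsubst A B G).
Proof.
move=> FG v vn; apply: eq_bigr => i _; apply: eq_bigr => w _; congr (_ * _).
by apply: FG; rewrite size_tuple; apply: leq_ltn_trans vn; rewrite -ltnS.
Qed.

End Substitution.

Lemma expX n w : (fX K ^+ n) w = (w == nseq n lx)%:R.
Proof.
elim: n w => [|n IH] w; first by rewrite expr0; case: w.
rewrite exprS; case: w => [|l w]; first by rewrite fmul_nil mul0r.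
rewrite fmul_cons {1}/fX /= mul0r add0r; case: l.
  have -> : lquot lx (fX K) = 1 by apply/funext => u; rewrite /lquot /fX eqseq_cons.
  by rewrite mul1r IH eqseq_cons.
have -> : lquot ly (fX K) = 0 by apply/funext.
by rewrite mul0r.
Qed.

End FpsAlgebra.

Section FpsExponential.
Variable K : numFieldType.
Implicit Types (A B C F G : fps K) (w v : word) (a b c : K).

Definition expX_coef c n : K := c ^+ n / n`!%:R.

Lemma fexpX c w : fexp (c *: fX K) w =
  if w == nseq (size w) lx then expX_coef c (size w) else 0.
Proof.
rewrite /fexp (eq_bigr (fun n : 'I__ => c ^+ n * (w == nseq n lx)%:R / n`!%:R)); last first.
  by move=> n _; rewrite exprZn -expX.
rewrite big_ord_recr /= big1 ?add0r; last first.
  move=> n _; case: eqP => [e|_]; last by rewrite mulr0 mul0r.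
  by have := ltn_ord n; rewrite {2}e size_nseq ltnn.
by case: ifP => _; rewrite ?mulr1 // mulr0 mul0r.
Qed.

Lemma fexpX_nseq c n : fexp (c *: fX K) (nseq n lx) = expX_coef c n.
Proof. by rewrite fexpX size_nseq eqxx. Qed.

Lemma all_nseqP w : (w == nseq (size w) lx) = all (pred1 lx) w.
Proof. by apply/eqP/all_pred1P. Qed.

(** On a power of x this is the binomial theorem; any other word has a letter y in one of the two
    factors of every splitting. *)
Lemma fexpXD a b : fexp (a *: fX K) * fexp (b *: fX K) = fexp ((a + b) *: fX K).
Proof.
apply/funext => w; rewrite fexpX.
transitivity (fmul (fexp (a *: fX K)) (fexp (b *: fX K)) w) => //; rewrite /fmul.
case: ifP => [/eqP wE|wN].
  have tE j : (j <= size w)%N -> take j w = nseq j lx.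
    by move=> jw; rewrite {1}wE take_nseq.
  have dE j : (j <= size w)%N -> drop j w = nseq (size w - j) lx.
    by move=> jw; rewrite {1}wE drop_nseq.
  rewrite /expX_coef addrC exprDn mulr_suml; apply: eq_bigr => i _.
  have iw : (i <= size w)%N by rewrite -ltnS.
  rewrite (tE _ iw) (dE _ iw) !fexpX_nseq /expX_coef.
  have -> : ((size w)`!)%:R = ('C(size w, i) * (i`! * (size w - i)`!))%N%:R :> K.
    by rewrite bin_fact.
  have f0 n : (n`!%:R : K) != 0 by rewrite pnatr_eq0 -lt0n fact_gt0.
  have c0 : ('C(size w, i)%:R : K) != 0 by rewrite pnatr_eq0 -lt0n bin_gt0.
  rewrite !natrM -mulr_natr; field.
  by rewrite !f0 c0.
rewrite big1 // => i _; rewrite !fexpX !all_nseqP.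
move: wN; rewrite all_nseqP -{1}(cat_take_drop i w) all_cat.
by case: (all _ _) => /= [->|_]; rewrite ?mulr0 ?mul0r.
Qed.

Definition texp N A : fps K := \sum_(n < N) (n`!%:R)^-1 *: A ^+ n.

Lemma fexp_trunc A N : A [::] = 0 -> agree N (fexp A) (texp N A).
Proof.
move=> A0 w wN; rewrite /texp fps_sumE /fexp.
rewrite (big_ord_widen N (fun n => (A ^+ n) w / n`!%:R)) //.
rewrite big_mkcond; apply: eq_bigr => n _.
have -> : (n`!%:R^-1 *: A ^+ n) w = n`!%:R^-1 * (A ^+ n) w by [].
by case: ltnP => wn; [rewrite mulrC|rewrite expr_low // mulr0].
Qed.

Lemma fsubst_fexp A B c : A [::] = 0 -> B [::] = 0 ->
  fsubst A B (fexp (c *: fX K)) = fexp (c *: A).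
Proof.
move=> A0 B0; apply/funext => w.
have cA0 : (c *: A) [::] = 0 by rewrite [LHS](_ : _ = c * A [::]) // A0 mulr0.
have cX0 : (c *: fX K) [::] = 0 by rewrite [LHS](_ : _ = c * 0) // mulr0.
rewrite (fexp_trunc cA0 (ltnSn (size w))).
rewrite (agree_fsubst A B (fexp_trunc cX0 (N := _)) (ltnSn (size w))).
rewrite /texp fsubst_sum //; congr (_ w); apply: eq_bigr => n _.
by rewrite fsubstZ fsubstXn // fsubstZ fsubstX.
Qed.

(** The substitution of A for X carries the exponent law over from X, where all coefficients are
    explicit. *)
Lemma fexpD A a b : A [::] = 0 ->
  fexp (a *: A) * fexp (b *: A) = fexp ((a + b) *: A).
Proof.
move=> A0; have e c := @fsubst_fexp A A c A0 A0.
by rewrite -(e a) -(e b) -(e (a + b)) -fsubstM // fexpXD.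
Qed.

Lemma fexp0 : fexp (0 : fps K) = 1.
Proof.
apply/funext => w; rewrite /fexp big_ord_recl expr0 fact0 divr1 big1 ?addr0 // => i _.
by rewrite exprS mul0r mul0r.
Qed.

Lemma fexp_nil A : fexp A [::] = 1.
Proof. by rewrite /fexp big_ord_recl big_ord0 addr0 expr0 fact0 divr1. Qed.

End FpsExponential.

(** * Asymptotics and uniqueness of KZ solutions *)

Section PolylogarithmAsymptotics.
Variable R : realType.
Variable Li : word -> R[i] -> R[i].
Hypothesis hLi : polylogarithms Li.
Implicit Types (z c : R[i]) (w v : word).

Lemma expX_coefS c n : n.+1%:R * expX_coef c n.+1 = c * expX_coef c n.
Proof.
rewrite /expX_coef exprS factS natrM.
have f0 : (n`!%:R : R[i]) != 0 by rewrite pnatr_eq0 -lt0n fact_gt0.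
have n0 : (n.+1%:R : R[i]) != 0 by rewrite pnatr_eq0.
by move: (n.+1%:R : R[i]) n0 => x x0; field; rewrite f0 x0.
Qed.

(* The coefficient of v x^k in G_0(z) z^{-X}. *)
Definition Lireg v k z : R[i] :=
  \sum_(m < k.+1) Li (v ++ nseq m lx) z * expX_coef (- clog z) (k - m).

(** A nonempty suffix of a word of h^1 contains its final y, and exp(c X) vanishes there: in the
    product with G_0 only the splittings inside the block of trailing x survive. *)
Lemma h1_drop v i : in_h1 v -> (i < size v)%N -> ~~ all (pred1 lx) (drop i v).
Proof.
rewrite /in_h1 -{1}(cat_take_drop i v) last_cat => + iv.
have : size (drop i v) != 0%N by rewrite size_drop subn_eq0 -ltnNge.
case: (drop i v) => // l d _ /= /eqP e; apply/negP => h.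
by have /(allP (a := pred1 lx) (s := l :: d) h) := mem_last l d; rewrite e.
Qed.

Lemma G0_LiregE v k z : in_h1 v ->
  (G0_series Li z * fexp (- clog z *: fX R[i])) (v ++ nseq k lx) = Lireg v k z.
Proof.
move=> hv; set e := fexp _.
transitivity (fmul (G0_series Li z) e (v ++ nseq k lx)) => //; rewrite /fmul.
rewrite -(big_mkord xpredT (fun i =>
  G0_series Li z (take i (v ++ nseq k lx)) * e (drop i (v ++ nseq k lx)))).
rewrite size_cat size_nseq (big_cat_nat _ (n := size v)) //=; last first.
  by rewrite ltnW // ltnS leq_addr.
rewrite big_nat big1 ?add0r; last first.
  move=> i /andP[_ iv]; rewrite drop_cat iv /e fexpX all_nseqP all_cat.
  by rewrite (negbTE (h1_drop hv iv)) mulr0.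
rewrite -{1}[size v]add0n big_addn -addnS addKn big_mkord; apply: eq_bigr => i _.
have ik : (i <= k)%N by rewrite -ltnS.
rewrite take_cat drop_cat ltnNge leq_addl /= addnK take_nseq // drop_nseq /e fexpX_nseq.
by [].
Qed.

(** In each term k + 1 is split as m + (k + 1 - m). The first part is rewritten by [Li_xrec], the
    second by [expX_coefS]; their multiples of log z cancel, and only the insertions remain. *)
Lemma Lireg_rec v k z : domD z ->
  k.+1%:R * Lireg v k.+1 z = - \sum_(v' <- xins v) Lireg v' k z.
Proof.
move=> zD; rewrite /Lireg mulr_sumr.
pose e := expX_coef (- clog z); pose L m := Li (v ++ nseq m lx) z.
transitivity (\sum_(m < k.+2) (m%:R * L m * e (k.+1 - m)%N) +
   \sum_(m < k.+2) ((k.+1 - m)%N%:R * e (k.+1 - m)%N * L m)).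
  rewrite -big_split; apply: eq_bigr => m _ /=.
  have mk : (m <= k.+1)%N by rewrite -ltnS.
  by rewrite -{1}(subnKC mk) natrD -/(L m) -/e; ring.
rewrite big_ord_recl mul0r mul0r add0r [X in _ + X]big_ord_recr /= subnn !mul0r addr0.
rewrite -big_split /= exchange_big /= -sumrN; apply: eq_bigr => m _.
have mk : (m <= k)%N by rewrite -ltnS.
rewrite /bump add1n subSS (subSn mk) /e expX_coefS -/e /L Li_xrec // -mulr_suml.
by rewrite -/(L m); ring.
Qed.

Lemma Li_h1_cvg0 v : in_h1 v -> v <> [::] ->
  Li v z @[z --> within (@domD R) (nbhs (0 : R[i]))] --> (0 : R[i]).
Proof.
move=> /in_h1_index[[|[//|k] ks] hks ->] // _.
have r1 : 0 < (1/2 : R) < 1 by apply/andP; split; lra.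
have r0 : 0 < (1/2 : R) by lra.
(* At m = 0 [psum_lead] measures the distance to the constant coefficient, which is 0 here; this
   gives a bound by K |z|. *)
have c0 n : (n < 0)%N -> pcoef R (k.+1 :: ks) n = 0 by [].
have [K K0 hK] := psum_lead r0 (pcoef_bounded hLi hks r1) c0.
have K1 : 0 < K + 1 by rewrite ltr_wpDl.
apply/cvg_cabsP => e e0; apply/nbhs_cabsP; exists (Num.min (1/4) (e / (K + 1))).
  by rewrite lt_min; apply/andP; split; [lra|rewrite divr_gt0 // ltr_wpDl].
move=> z; rewrite subr0 lt_min (ltr_pdivlMr _ _ K1) => /andP[z4 ze] zD.
have z1 : cabs z < 1 by lra.
have z2 : cabs z <= 1 / 2 / 2 by lra.
have := hK z _ z2 (Li_psum hLi hks zD z1); rewrite pcoef0 mul0r expr1.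
move/le_lt_trans; apply; apply: le_lt_trans ze.
by rewrite mulrC ler_wpM2l ?cabs_ge0 // lerDl.
Qed.

Lemma Lireg_cvg v k : in_h1 v ->
  Lireg v k z @[z --> within (@domD R) (nbhs (0 : R[i]))] -->
  (((v == [::]) && (k == 0%N))%:R : R[i]).
Proof.
elim: k v => [|k IH] v hv.
  have -> : Lireg v 0 = Li v.
    by apply/funext => z; rewrite /Lireg big_ord1 cats0 /expX_coef expr0 fact0 divr1 mulr1.
  rewrite andbT; case: eqVneq => [->|/eqP v0]; last exact: Li_h1_cvg0.
  by apply: cvg_cst_cabs; apply/nbhs_cabsP; exists 1 => // z _ zD; rewrite Li_nil.
rewrite andbF.
have k0 : (k.+1%:R : R[i]) != 0 by rewrite pnatr_eq0.
have h : (fun z => - k.+1%:R^-1 * \sum_(v' <- xins v | v' \in xins v) Lireg v' k z)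
    @ within (@domD R) (nbhs (0 : R[i])) -->
    - k.+1%:R^-1 * \sum_(v' <- xins v | v' \in xins v) (0 : R[i]).
  apply: cvgM_complex; first exact: cvg_cst_complex.
  apply: cvg_sum_complex => v' /(xins_h1 hv)[hv' /eqP/negbTE v'0].
  by have := IH _ hv'; rewrite v'0.
have s0 : - k.+1%:R^-1 * \sum_(v' <- xins v | v' \in xins v) (0 : R[i]) = 0.
  by rewrite big1 ?mulr0.
rewrite s0 in h; apply: cvg_near_eq h; apply/nbhs_cabsP; exists 1 => // z _ zD.
by rewrite -big_seq mulNr -mulrN -Lireg_rec // mulKf.
Qed.

Lemma G0_asymptotic : fps_cvg1 (within (@domD R) (nbhs (0 : R[i])))
  (fun z => G0_series Li z * fexp (- clog z *: fX R[i])).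
Proof.
move=> w; have [v [k [hv ->]]] := word_h1_split w.
have -> : (1 : fps R[i]) (v ++ nseq k lx) = ((v == [::]) && (k == 0%N))%:R.
  by case: v hv => [|//] _; case: k.
have -> : (fun z => (G0_series Li z * fexp (- clog z *: fX R[i])) (v ++ nseq k lx)) =
   Lireg v k by apply/funext => z; rewrite G0_LiregE.
exact: Lireg_cvg.
Qed.

End PolylogarithmAsymptotics.

(** * Uniqueness and transport of KZ solutions *)

Section KZSolutions.
Variable R : realType.
Local Notation C := R[i].
Implicit Types (z : C) (w : word) (G : C -> fps C) (U : set C) (F : fps C).

Definition kz_coef z : fps C := z^-1 *: fX C + (1 - z)^-1 *: fY C.

Lemma kz_coefM_nil z F : (kz_coef z * F) [::] = 0.
Proof.
rewrite fmul_nil [kz_coef z _](_ : _ = z^-1 * 0 + (1 - z)^-1 * 0) //.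
by rewrite !mulr0 addr0 mul0r.
Qed.

(** The equation is triangular: the derivative at a word involves only the word without its first
    letter. Hence agreement in smaller length makes the difference of two solutions locally
    constant. *)
Lemma kz_coefM_cons z F l w : (kz_coef z * F) (l :: w) = kz_form l z * F w.
Proof.
rewrite fmul_cons [kz_coef z _](_ : _ = z^-1 * 0 + (1 - z)^-1 * 0) // !mulr0 addr0 mul0r add0r.
have -> : lquot l (kz_coef z) = kz_form l z *: 1.
  apply/funext => u; case: l.
    by transitivity (z^-1 * (u == [::])%:R + (1 - z)^-1 * 0); rewrite // mulr0 addr0.
  by transitivity (z^-1 * 0 + (1 - z)^-1 * (u == [::])%:R); rewrite // mulr0 add0r.
by rewrite -scalerAl mul1r.
Qed.

Lemma KZ_solutionP U G : KZ_solution U G <->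
  forall z, U z -> forall w, cderiv (fun t => G t w) z ((kz_coef z * G z) w).
Proof. by split=> h z Uz w; apply/is_derive_cderivP; exact: h. Qed.

Lemma KZ_solutionMr U G F : KZ_solution U G -> KZ_solution U (fun z => G z * F).
Proof.
move=> /KZ_solutionP h; apply/KZ_solutionP => z Uz w; rewrite mulrA.
have -> : (kz_coef z * G z * F) w =
    \sum_(i < (size w).+1) ((kz_coef z * G z) (take i w) * F (drop i w) + G z (take i w) * 0).
  by apply: eq_bigr => i _; rewrite mulr0 addr0.
have := @cderiv_sum R _ (index_enum 'I_(size w).+1) xpredT
  (fun i t => G t (take i w) * F (drop i w)) z
  (fun i => (kz_coef z * G z) (take i w) * F (drop i w) + G z (take i w) * 0).
apply=> i _; apply: (@cderivM _ (fun t => G t (take i w)) (fun=> F (drop i w))).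
  exact: h.
exact: cderiv_cst.
Qed.

Lemma G0_KZ (Li : word -> C -> C) : polylogarithms Li ->
  KZ_solution (@domD R) (G0_series Li).
Proof.
move=> hLi; apply/KZ_solutionP => z zD [|l w].
  by rewrite kz_coefM_nil; exact: (Li_cderiv hLi [::] zD).
by rewrite kz_coefM_cons; exact: (Li_cderiv hLi (l :: w) zD).
Qed.

Lemma KZ_unique U (c0 : C) T (S : set_system T) {FS : ProperFilter S} (g : T -> C)
    (G G' P : C -> fps C) :
  (forall z (t : R), U z -> 0 <= t <= 1 -> U (c0 + t%:C * (z - c0))) ->
  KZ_solution U G -> KZ_solution U G' ->
  (\forall x \near S, U (g x)) -> (forall z, P z [::] = 1) ->
  (forall w, (G (g x) * P (g x)) w @[x --> S] --> (1 : fps C) w) ->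
  (forall w, (G' (g x) * P (g x)) w @[x --> S] --> (1 : fps C) w) ->
  forall z, U z -> G z = G' z.
Proof.
move=> star /KZ_solutionP hG /KZ_solutionP hG' gU P1 cG cG'.
suff h n : forall w, (size w < n)%N -> forall z, U z -> G z w = G' z w.
  by move=> z Uz; apply/funext => w; apply: (h (size w).+1).
elim: n => // n IH w wn.
have dw0 z : U z -> G z w - G' z w = G c0 w - G' c0 w.
  move=> Uz; rewrite -{1 2}(subrKC c0 z).
  apply: (@cderiv0_segment _ (fun t => G t w - G' t w)) => t t01.
  have Ut := star _ _ Uz t01.
  have := cderivB (hG _ Ut w) (hG' _ Ut w).
  suff -> : forall u, U u -> (kz_coef u * G u) w - (kz_coef u * G' u) w = 0 by [].
  move=> u Uu; apply/eqP; rewrite subr_eq0; apply/eqP.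
  case: w wn {Ut} => [|l w] wn; first by rewrite !kz_coefM_nil.
  by rewrite !kz_coefM_cons (IH w).
suff d0 : G c0 w - G' c0 w = 0.
  by move=> z Uz; apply/eqP; rewrite -subr_eq0 dw0 // d0.
have h : (fun x => (G (g x) * P (g x)) w - (G' (g x) * P (g x)) w) @ S -->
    (1 : fps C) w - (1 : fps C) w by exact: cvgB_complex.
rewrite subrr in h; apply: cvg_unique_complex _ h.
apply: cvg_cst_cabs; apply: filterS gU => x Ux.
rewrite -(dw0 _ Ux).
transitivity (fmul (G (g x)) (P (g x)) w - fmul (G' (g x)) (P (g x)) w) => //.
(* Every term but the last contains a proper prefix of w, where the two solutions agree; the last is
   the constant difference times the constant term 1 of P. *)
rewrite /fmul -sumrB big_ord_recr /= big1 ?add0r; last first.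
  move=> i _; rewrite -mulrBl (IH (take i w)) ?subrr ?mul0r //.
  by rewrite size_takel ?(ltnW (ltn_ord i)) //; apply: leq_trans (ltn_ord i) _; rewrite -ltnS.
by rewrite take_size drop_size P1 !mulr1.
Qed.

(** Each coefficient of [fexp (c *: F)] is a polynomial in c, and at c = 0 it is the coefficient of
    1. *)
Lemma fexp_cvg1 T (S : set_system T) {FS : Filter S} (k : T -> C) F w :
  k x @[x --> S] --> (0 : C) -> fexp (k x *: F) w @[x --> S] --> (1 : fps C) w.
Proof.
move=> k0; rewrite -fexp0 -[in X in _ --> X](scale0r F).
have fexpZE c : fexp (c *: F) w = \sum_(n < (size w).+1) c ^+ n * ((F ^+ n) w / n`!%:R).
  by apply: eq_bigr => n _; rewrite exprZn mulrA.
rewrite fexpZE; under eq_fun do rewrite fexpZE.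
apply: cvg_sum_complex => n _; apply: cvgM_complex; last exact: cvg_cst_complex.
elim: (val n) => [|m IH]; first by under eq_fun do rewrite expr0; exact: cvg_cst_complex.
rewrite exprS; have -> : (fun x => k x ^+ m.+1) = (fun x => k x * k x ^+ m).
  by apply/funext => x; rewrite exprS.
exact: (cvgM_complex k0 IH).
Qed.

Lemma fmul_cvg1 T (S : set_system T) {FS : Filter S} (F G : T -> fps C) :
  (forall w, F x w @[x --> S] --> (1 : fps C) w) ->
  (forall w, G x w @[x --> S] --> (1 : fps C) w) ->
  forall w, (F x * G x) w @[x --> S] --> (1 : fps C) w.
Proof.
move=> cF cG w; rewrite -[1 in X in _ --> X](mulr1 1).
by apply: cvg_sum_complex => i _; exact: cvgM_complex.
Qed.

Lemma fsubst_cvg1 T (S : set_system T) {FS : Filter S} (A B : fps C) (F : T -> fps C) :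
  A [::] = 0 -> B [::] = 0 ->
  (forall w, F x w @[x --> S] --> (1 : fps C) w) ->
  forall w, fsubst A B (F x) w @[x --> S] --> (1 : fps C) w.
Proof.
move=> A0 B0 cF w; rewrite -[1 in X in _ --> X](fsubst1 A0 B0).
apply: cvg_sum_complex => n _; apply: cvg_sum_complex => v _.
by apply: cvgM_complex => //; exact: cvg_cst_complex.
Qed.

Lemma cvg_comp_complex T (S : set_system T) (S' : set_system C) (g : T -> C) (h : C -> C) (l : C) :
  g @ S --> S' -> h @ S' --> l -> (fun x => h (g x)) @ S --> l.
Proof. by move=> gS hS Q /hS /gS. Qed.

Section Transport.
Variable Li : word -> C -> C.
Hypothesis hLi : polylogarithms Li.
Variable f : lft.
Local Notation A := (lft_X C f).
Local Notation B := (lft_Y C f).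
Local Notation u := (lft_fun (lft_inv f)).

Lemma lft_X0 : A [::] = 0.
Proof.
case: f => //=; try by rewrite [LHS](_ : _ = - 0) // oppr0.
  by rewrite [LHS](_ : _ = - 0 + 0) // oppr0 addr0.
by rewrite [LHS](_ : _ = - 0 + 0) // oppr0 addr0.
Qed.

Lemma lft_Y0 : B [::] = 0.
Proof.
case: f => //=; try by rewrite [LHS](_ : _ = - 0) // oppr0.
  by rewrite [LHS](_ : _ = 0 - 0) // oppr0 addr0.
by rewrite [LHS](_ : _ = 0 - 0) // oppr0 addr0.
Qed.

(** The last hypothesis says that the KZ form, with its letters replaced by their images and pulled
    back along f^{-1}, is the KZ form itself; the chain rule and the multiplicativity of the
    substitution give the rest. *)
Lemma lft_op_KZ U (u' : C -> C) :
  (forall z, U z -> domD (u z)) -> (forall z, U z -> cderiv u z (u' z)) ->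
  (forall z, U z -> u' z *: ((u z)^-1 *: A + (1 - u z)^-1 *: B) = kz_coef z) ->
  KZ_solution U (lft_op f (G0_series Li)).
Proof.
move=> uD du uE; apply/KZ_solutionP => z Uz w.
have -> : kz_coef z * lft_op f (G0_series Li) z =
    u' z *: fsubst A B (kz_coef (u z) * G0_series Li (u z)).
  rewrite -uE // fsubstM ?lft_X0 ?lft_Y0 // fsubstD !fsubstZ.
  by rewrite fsubstX ?fsubstY ?lft_X0 ?lft_Y0 // -scalerAl.
have /KZ_solutionP hG0 := G0_KZ hLi.
have dG v : cderiv (fun t => Li v (u t)) z ((kz_coef (u z) * G0_series Li (u z)) v * u' z).
  exact: (cderiv_comp (du z Uz) (hG0 _ (uD z Uz) v)).
set K := kz_coef (u z) * _ in dG *.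
have -> : (u' z *: fsubst A B K) w = \sum_(n < (size w).+1) \sum_(v : n.-tuple letter)
   (K v * u' z * fword A B v w + Li v (u z) * 0).
  transitivity (u' z * fsubst A B K w) => //; rewrite /fsubst mulr_sumr.
  apply: eq_bigr => n _; rewrite mulr_sumr; apply: eq_bigr => v _; ring.
rewrite /lft_op /fsubst.
apply: (@cderiv_sum R _ (index_enum 'I_(size w).+1) xpredT
  (fun n t => \sum_(v : n.-tuple letter) G0_series Li (u t) v * fword A B v w)) => n _.
apply: (@cderiv_sum R _ (index_enum (n.-tuple letter)) xpredT
  (fun v t => G0_series Li (u t) v * fword A B v w)) => v _.
apply: (@cderivM _ (fun t => Li v (u t)) (fun=> fword A B v w)); first exact: dG.
exact: cderiv_cst.
Qed.

Lemma lft_op_asymptotic T (S : set_system T) {FS : Filter S} (g : T -> C) :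
  u (g x) @[x --> S] --> within (@domD R) (nbhs (0 : C)) ->
  forall w, (lft_op f (G0_series Li) (g x) * fexp (- clog (u (g x)) *: A)) w @[x --> S]
    --> (1 : fps C) w.
Proof.
move=> cu w.
have -> : (fun x => (lft_op f (G0_series Li) (g x) * fexp (- clog (u (g x)) *: A)) w) =
   (fun x => fsubst A B (G0_series Li (u (g x)) * fexp (- clog (u (g x)) *: fX C)) w).
  by apply/funext => x; rewrite fsubstM ?fsubst_fexp ?lft_X0 ?lft_Y0.
apply: fsubst_cvg1; [exact: lft_X0|exact: lft_Y0|move=> v].
exact: (@cvg_comp_complex _ S (within (@domD R) (nbhs (0 : C))) (fun x => u (g x))
  (fun z => (G0_series Li z * fexp (- clog z *: fX C)) v) _ cu (@G0_asymptotic R Li hLi v)).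
Qed.

Lemma lft_op_connection U (c0 c : C) T (S : set_system T) {FS : ProperFilter S}
    (g : T -> C) (a : C -> C) (u' : C -> C) G :
  (forall z (t : R), U z -> 0 <= t <= 1 -> U (c0 + t%:C * (z - c0))) ->
  KZ_solution U G ->
  (forall z, U z -> domD (u z)) -> (forall z, U z -> cderiv u z (u' z)) ->
  (forall z, U z -> u' z *: ((u z)^-1 *: A + (1 - u z)^-1 *: B) = kz_coef z) ->
  (\forall x \near S, U (g x)) ->
  u (g x) @[x --> S] --> (0 : C) ->
  clog (u (g x)) - clog (a (g x)) @[x --> S] --> c ->
  (forall w, (G (g x) * fexp (- clog (a (g x)) *: A)) w @[x --> S] --> (1 : fps C) w) ->
  forall z, U z -> lft_op f (G0_series Li) z = G z * fexp (c *: A).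
Proof.
move=> star hG uD du uE gU cu clogu cG.
(* The inverse of the common asymptotic behaviour. Against pi(f)(G_0) it leaves a factor with
   exponent log u - log a - c, which tends to 0; against G exp(c A) it leaves exactly the
   normalization of G. *)
pose P z := fexp ((- (clog (a z) + c)) *: A).
have cuD : u (g x) @[x --> S] --> within (@domD R) (nbhs (0 : C)).
  move=> Q QD; have h : S (fun x => domD (u (g x)) -> Q (u (g x))) by exact: (cu _ QD).
  by apply: filterS2 h gU => x Qx /uD.
have P1 z : P z [::] = 1 by exact: fexp_nil.
apply: (KZ_unique star (lft_op_KZ uD du uE) (KZ_solutionMr (fexp (c *: A)) hG) gU P1).
- move=> w.
  have -> : (fun x => (lft_op f (G0_series Li) (g x) * P (g x)) w) = (fun x =>
      (lft_op f (G0_series Li) (g x) * fexp (- clog (u (g x)) *: A) *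
       fexp ((clog (u (g x)) - clog (a (g x)) - c) *: A)) w).
    apply/funext => x; rewrite -mulrA (@fexpD _ A _ _ lft_X0) /P.
    set k := _ + (_ - _ - c); suff -> : - (clog (a (g x)) + c) = k by [].
    by rewrite /k; ring.
  apply: fmul_cvg1 => [|v]; first exact: lft_op_asymptotic.
  have k0 : (fun x => clog (u (g x)) - clog (a (g x)) - c) @ S --> (0 : C).
    by rewrite -(subrr c); exact: (cvgB_complex clogu (@cvg_cst_complex _ _ S _ c)).
  have h := @fexp_cvg1 T S _ _ A v k0; exact: h.
- move=> w.
  have -> : (fun x => (G (g x) * fexp (c *: A) * P (g x)) w) =
     (fun x => (G (g x) * fexp (- clog (a (g x)) *: A)) w).
    apply/funext => x; rewrite -mulrA /P (@fexpD _ A _ _ lft_X0).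
    set k := c + _; suff -> : - clog (a (g x)) = k by [].
    by rewrite /k; ring.
  exact: cG.
Qed.

End Transport.
End KZSolutions.

(** * Connection along rays *)

Section Rays.
Variable R : realType.
Local Notation C := R[i].
Implicit Types (z s : C) (t e : R).

Lemma near_right0 e (P : set R) : 0 < e -> (forall t, 0 < t < e -> P t) ->
  \forall t \near 0^'+, P t.
Proof.
move=> e0 h; near=> t; apply: h; apply/andP; split; near: t.
  exact: nbhs_right_gt.
exact: nbhs_right_lt.
Unshelve. all: by end_near. Qed.

Definition ray s t : C := t%:C * s.

Variable s : C.
Hypothesis s1 : cabs s = 1.

Lemma cabs_ray t : 0 < t -> cabs (ray s t) = t.
Proof. by move=> t0; rewrite cabsM cabs_real s1 mulr1 gtr0_norm. Qed.

Lemma ray_neq0 t : 0 < t -> ray s t != 0.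
Proof. by move=> t0; rewrite -cabs_gt0 cabs_ray. Qed.

Lemma ray_cvg0 : ray s t @[t --> 0^'+] --> (0 : C).
Proof.
apply/cvg_cabsP => e e0; apply: (near_right0 e0) => t /andP[t0 te].
by rewrite subr0 cabs_ray.
Qed.

Lemma ray_within (D : set C) e (g : R -> C) (l : C) : 0 < e ->
  (forall t, 0 < t < e -> D (g t)) -> g @ 0^'+ --> l -> g @ 0^'+ --> within D (nbhs l).
Proof.
move=> e0 hD gl Q QD.
have h : (0:R)^'+ (fun t => D (g t) -> Q (g t)) by exact: (gl _ QD).
by apply: filterS2 h (near_right0 e0 hD) => t Qt /Qt.
Qed.

Lemma ray_inv_infty (D : set C) e : 0 < e ->
  (forall t, 0 < t < e -> D (ray s t)^-1) ->
  (ray s t)^-1 @[t --> 0^'+] --> within D (@cinfty_nbhs R).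
Proof.
move=> e0 hD Q [M _ hM].
have M0 : 0 < `|M| + 1 by rewrite ltr_wpDl.
have m0 : 0 < Num.min e (`|M| + 1)^-1 by rewrite lt_min e0 invr_gt0.
apply: (near_right0 m0) => t; rewrite lt_min => /and3P[t0 te tM].
apply: hM; last by apply: hD; rewrite t0.
rewrite /= cabsV cabs_ray //; apply: (@lt_trans _ _ (`|M| + 1)).
  by apply: le_lt_trans (ler_norm M) _; rewrite ltrDl.
by rewrite -[X in X < _]invrK ltf_pV2 ?posrE // invr_gt0.
Qed.

Lemma ray_1m_cvg : (1 - ray s t) @[t --> 0^'+] --> (1 : C).
Proof.
by rewrite -[X in _ --> X](subr0 1); exact: (cvgB_complex (@cvg_cst_complex _ _ _ _ _) ray_cvg0).
Qed.

Lemma ray_1m_inv_cvg : (1 - ray s t)^-1 @[t --> 0^'+] --> (1 : C).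
Proof.
have h := cderiv_continuous (cderivV (oner_neq0 C)); rewrite invr1 in h.
exact: cvg_comp_complex ray_1m_cvg h.
Qed.

End Rays.

(** * The jump of the logarithm along an imaginary ray *)

Section HalfPlaneLogarithm.
Variable R : realType.
Local Notation C := R[i].
Variable s : R.
Hypothesis hs : s = 1 \/ s = -1.
Local Notation r := (ray (0 +i* s)).

Lemma cabs_imag : cabs (0 +i* s : C) = 1.
Proof.
rewrite cabsE /= expr0n add0r.
by case: hs => ->; rewrite ?sqrrN expr1n sqrtr1.
Qed.

Lemma ray_imag (t : R) : r t = 0 +i* (t * s).
Proof. by apply/eqP; rewrite eq_complex /= !mul0r !mulr0 subr0 addr0 !eqxx. Qed.

Lemma clog_N_ray (t : R) : 0 < t -> clog (- r t) = clog (r t) + 0 +i* (- s * pi).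
Proof.
move=> t0; rewrite ray_imag; case: hs => ->.
  rewrite clogN_Im_gt0 /= ?mulr1 //; congr (_ + _).
  by apply/eqP; rewrite eq_complex /= oppr0 mulN1r !eqxx.
by rewrite clogN_Im_lt0 /= ?mulrN1 ?oppr_lt0 // opprK mul1r.
Qed.

Lemma carg_imag (y : R) : y != 0 -> - (pi / 2) <= carg (0 +i* y : C) <= pi / 2.
Proof.
move=> y0; have pi0 := pi_gt0 R.
have acE : acos ((0 : R) / cabs (0 +i* y : C)) = pi / 2 by rewrite mul0r acos0.
rewrite /carg /= acE; case: ifP => _; rewrite ?lexx ?andbT ?lerN2.
  by apply: le_trans (_ : 0 <= _); [rewrite oppr_le0 divr_ge0 // ltW|rewrite divr_ge0 // ltW].
by apply: le_trans (_ : 0 <= _); [rewrite oppr_le0 divr_ge0 // ltW|rewrite divr_ge0 // ltW].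
Qed.

(** The quotient is (- r)(1 - r)^{-1}. The first factor is purely imaginary and the second has
    positive real part, so their arguments add up inside the principal range and the logarithms add;
    the second logarithm tends to 0. *)
Lemma clog_ray_cvg :
  clog (r t / (r t - 1)) - clog (r t) @[t --> 0^'+] --> (0 +i* (- s * pi) : C).
Proof.
have s0 : s != 0 by case: hs => ->; rewrite ?oppr_eq0 oner_eq0.
have clog1 : clog (1 : C) = 0.
  by rewrite /clog cabs1 ln1 carg_Re_gt0 /= ?ltr01 // mul0r atan0.
have b1 := ray_1m_inv_cvg cabs_imag.
have lb : clog (1 - r t)^-1 @[t --> 0^'+] --> (0 : C).
  have h := cderiv_continuous (@cderiv_clog1 R); rewrite clog1 in h.
  exact: cvg_comp_complex b1 h.
have L : (0 +i* (- s * pi) + clog (1 - r t)^-1 : C) @[t --> 0^'+] --> (0 +i* (- s * pi) : C).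
  rewrite -[X in _ --> X](addr0 (0 +i* (- s * pi))).
  exact: (cvgD_complex (@cvg_cst_complex _ _ _ _ _) lb).
apply: cvg_near_eq L.
apply: (@near_right0 _ 1) => // t /andP[t0 t1].
have rn0 : r t != 0 by apply: ray_neq0 => //; exact: cabs_imag.
have Re1 : complex.Re (1 - r t) = 1 by rewrite ray_imag ReD ReN /= oppr0 addr0.
have n0 : 1 - r t != 0.
  by apply: contraTneq (oner_neq0 R) => /(congr1 (@complex.Re R)); rewrite Re1 => ->; rewrite eqxx.
have -> : r t / (r t - 1) = - r t * (1 - r t)^-1.
  by rewrite -[r t - 1]opprB invrN mulrN mulNr.
rewrite clogM ?oppr_eq0 ?invr_eq0 //.
  by rewrite clog_N_ray //; ring.
have Rb : 0 < complex.Re (1 - r t)^-1.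
  move: Re1 n0; case: (1 - r t) => x y /= -> _; rewrite divr_gt0 //.
  by rewrite expr1n ltr_pwDl // sqr_ge0.
have /andP[h1 h2] := carg_Re_gt0_bound Rb.
have : - (pi / 2) <= carg (- r t) <= pi / 2.
  have -> : - r t = 0 +i* (- (t * s)).
    by rewrite ray_imag; apply/eqP; rewrite eq_complex /= oppr0 !eqxx.
  by apply: carg_imag; rewrite oppr_eq0 mulf_neq0 // gt_eqF.
by move=> /andP[h3 h4]; apply/andP; split; lra.
Qed.

Lemma ray_mob_cvg0 : (r t / (r t - 1)) @[t --> 0^'+] --> (0 : C).
Proof.
have r0 := ray_cvg0 cabs_imag; have b1 := ray_1m_inv_cvg cabs_imag.
have h := cvgM_complex (cvgM_complex (@cvg_cst_complex R _ 0^'+ _ (-1 : C)) r0) b1.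
rewrite mulr0 mul0r in h.
suff -> : (fun t => r t / (r t - 1)) = (fun t => -1 * r t * (1 - r t)^-1) by exact: h.
by apply/funext => t; rewrite -[r t - 1]opprB invrN mulrN mulN1r mulNr.
Qed.

Definition half_plane : set C := [set z | 0 < s * complex.Im z].

Lemma half_plane_star z (t : R) : half_plane z -> 0 <= t <= 1 ->
  half_plane ((0 +i* s) + t%:C * (z - (0 +i* s))).
Proof.
rewrite /half_plane /= => h /andP[t0 t1].
have -> : complex.Im ((0 +i* s) + t%:C * (z - (0 +i* s))) = s + t * (complex.Im z - s).
  by case: (z) => x y /=; rewrite mul0r addr0.
have ss : s * s = 1 by case: hs => ->; rewrite ?mulr1 // mulrNN mulr1.
have -> : s * (s + t * (complex.Im z - s)) = (1 - t) * (s * s) + t * (s * complex.Im z) by ring.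
rewrite ss mulr1; have [->|tn1] := eqVneq t 1; first by rewrite subrr add0r mul1r.
by rewrite ltr_pwDl ?subr_gt0 ?lt_neqAle ?tn1 // mulr_ge0 // ltW.
Qed.

Lemma half_plane_Im z : half_plane z -> complex.Im z != 0.
Proof. by rewrite /half_plane /= => h; apply: contraTneq h => ->; rewrite mulr0 ltxx. Qed.

End HalfPlaneLogarithm.

Section Connections.
Variable R : realType.
Local Notation C := R[i].
Local Notation X := (fX C).
Local Notation Y := (fY C).
Variable Li : word -> C -> C.
Hypothesis hLi : polylogarithms Li.
Local Notation G0 := (G0_series Li).
Implicit Types (z : C) (f : lft).

Definition lft_der f z : C :=
  match f with
  | Lz => 1
  | L1mz => - 1
  | Linvz => - z ^- 2
  | Lz_zm1 => - (z - 1) ^- 2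
  | Linv1mz => (1 - z) ^- 2
  | Lzm1_z => z ^- 2
  end.

Lemma lft_cderiv f z : z != 0 -> 1 - z != 0 -> cderiv (lft_fun f) z (lft_der f z).
Proof.
move=> z0 z1; have z1' : z - 1 != 0 by rewrite -oppr_eq0 opprB.
have did := @cderiv_id R z; have dc := @cderiv_cst R 1 z.
have dV := cderivV z0.
have d1 : cderiv (fun w : C => 1 - w) z (-1).
  by have := cderivB dc did; rewrite sub0r.
have d2 : cderiv (fun w : C => w - 1) z 1.
  by have := cderivB did dc; rewrite subr0.
case: f => //=.
- have := cderivZ 1 dV; rewrite mul1r; exact.
- have := cderivM did (cderiv_comp d2 (cderivV z1')).
  have -> : 1 * (z - 1)^-1 + id z * (- (z - 1) ^- 2 * 1) = - (z - 1) ^- 2.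
    by rewrite /=; field.
  exact.
- have := cderivZ 1 (cderiv_comp d1 (cderivV z1)).
  have -> : 1 * (- (1 - z) ^- 2 * -1) = (1 - z) ^- 2 by rewrite mul1r mulrN1 opprK.
  exact.
- have := cderivM d2 dV.
  have -> : 1 * z^-1 + (z - 1) * - z ^- 2 = z ^- 2 by field.
  exact.
Qed.

(** This identity of differential forms is what dictates the images of X and Y under f_* in each
    case. *)
Lemma lft_kz f z : z != 0 -> 1 - z != 0 ->
  lft_der (lft_inv f) z *:
    ((lft_fun (lft_inv f) z)^-1 *: lft_X C f + (1 - lft_fun (lft_inv f) z)^-1 *: lft_Y C f) =
  kz_coef z.
Proof.
move=> z0 z1; have z1' : z - 1 != 0 by rewrite -oppr_eq0 opprB.
have z2 : z - (z - 1) != 0 by rewrite subKr oner_eq0.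
have z3 : z - 1 - z != 0 by rewrite addrAC subrr add0r oppr_eq0 oner_eq0.
have z4 : 1 - (1 - z) != 0 by rewrite subKr.
have z5 : 1 - z - 1 != 0 by rewrite addrAC subrr add0r oppr_eq0.
apply/funext => w; rewrite [RHS](_ : _ = z^-1 * X w + (1 - z)^-1 * Y w) //.
set u := lft_fun _ _; set d := lft_der _ _.
transitivity (d * (u^-1 * lft_X C f w + (1 - u)^-1 * lft_Y C f w)) => //.
rewrite /u /d; case: f {u d} => /=.
- by rewrite mul1r.
- rewrite [(- Y) w](_ : _ = - Y w) // [(- X) w](_ : _ = - X w) //.
  by move: (X w) (Y w) => x y; field; rewrite z0 z1.
- rewrite [(- X + Y) w](_ : _ = - X w + Y w) //.
  by move: (X w) (Y w) => x y; field; rewrite z0 z1 z1'.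
- rewrite [(X - Y) w](_ : _ = X w - Y w) //.
  by move: (X w) (Y w) => x y; field; rewrite z0 z1 z1' z3.
- rewrite [(- Y) w](_ : _ = - Y w) // [(X - Y) w](_ : _ = X w - Y w) //.
  by move: (X w) (Y w) => x y; field; rewrite z0 z1 z1' z2.
- rewrite [(- X + Y) w](_ : _ = - X w + Y w) // [(- X) w](_ : _ = - X w) //.
  by move: (X w) (Y w) => x y; field; rewrite z0 z1 z5.
Qed.

Lemma Im_inv z : complex.Im z != 0 -> complex.Im z^-1 != 0.
Proof.
case: z => x y /= y0; rewrite oppr_eq0 mulf_neq0 // invr_eq0 gt_eqF //.
by rewrite ltr_wpDl ?sqr_ge0 // lt_def sqr_ge0 sqrf_eq0 y0.
Qed.

(** Hence each transformation maps both half planes into D, where G_0 is known to be a solution. *)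
Lemma Im_neq0_lft z f : complex.Im z != 0 -> complex.Im (lft_fun f z) != 0.
Proof.
move=> i0; have z0 : z != 0 by apply: contraNneq i0 => ->.
have i1 : complex.Im (z - 1) != 0 by rewrite ImD ImN /= oppr0 addr0.
have i1' : complex.Im (1 - z) != 0 by rewrite ImD ImN /= add0r oppr_eq0.
have z1 : z - 1 != 0 by apply: contraNneq i1 => ->.
case: f => //=; rewrite ?mul1r; try exact: Im_inv.
- have -> : z / (z - 1) = 1 + (z - 1)^-1 by field.
  by rewrite ImD /= add0r Im_inv.
- have -> : (z - 1) / z = 1 - z^-1 by field.
  by rewrite ImD ImN /= add0r oppr_eq0 Im_inv.
Qed.

(* In every case the solution G is compared with pi(f)(G_0) along a path
   p(t) -> 0, 1 or infinity on which the local parameter a is the ray t s. *)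
Lemma lft_op_ray f U (c0 c s : C) (a : C -> C) (p : R -> C) G e :
  cabs s = 1 -> 0 < e ->
  (forall z (t : R), U z -> 0 <= t <= 1 -> U (c0 + t%:C * (z - c0))) ->
  KZ_solution U G ->
  (forall z, U z -> [/\ z != 0, 1 - z != 0 & domD (lft_fun (lft_inv f) z)]) ->
  (forall t, 0 < t < e -> U (p t) /\ a (p t) = ray s t) ->
  lft_fun (lft_inv f) (p t) @[t --> 0^'+] --> (0 : C) ->
  clog (lft_fun (lft_inv f) (p t)) - clog (ray s t) @[t --> 0^'+] --> c ->
  (forall w, (G (p t) * fexp (- clog (a (p t)) *: lft_X C f)) w @[t --> 0^'+]
     --> (1 : fps C) w) ->
  forall z, U z -> lft_op f G0 z = G z * fexp (c *: lft_X C f).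
Proof.
move=> s1 e0 star hG UP hp cu cc cG.
have gU : \forall t \near (0:R)^'+, U (p t) by apply: (near_right0 e0) => t /hp[].
have uD z : U z -> domD (lft_fun (lft_inv f) z) by move=> /UP[].
have du z : U z -> cderiv (lft_fun (lft_inv f)) z (lft_der (lft_inv f) z).
  by move=> /UP[z0 z1 _]; exact: lft_cderiv.
have kzE z : U z -> lft_der (lft_inv f) z *: ((lft_fun (lft_inv f) z)^-1 *: lft_X C f +
    (1 - lft_fun (lft_inv f) z)^-1 *: lft_Y C f) = kz_coef z.
  by move=> /UP[z0 z1 _]; exact: lft_kz.
have ca : clog (lft_fun (lft_inv f) (p t)) - clog (a (p t)) @[t --> 0^'+] --> c.
  by apply: cvg_near_eq cc; apply: (near_right0 e0) => t /hp[_ ->].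
exact: (lft_op_connection hLi star hG uD du kzE gU cu ca cG).
Qed.

End Connections.

(** * The connection formulas *)

Section ConnectionFormulas.
Variable R : realType.
Local Notation C := R[i].
Local Notation X := (fX C).
Local Notation Y := (fY C).
Variable Li : word -> C -> C.
Hypothesis hLi : polylogarithms Li.
Local Notation G0 := (G0_series Li).
Implicit Types (z s : C) (t : R).

Lemma KZ_solution_sub (U V : set C) G : U `<=` V -> KZ_solution V G -> KZ_solution U G.
Proof. by move=> UV h z /UV; exact: h. Qed.

Lemma domDinf_Im z : complex.Im z != 0 -> domDinf z.
Proof. by move=> /eqP h []. Qed.

Lemma domDinfP z : domDinf z <-> complex.Im z != 0 \/ 1 < complex.Re z.
Proof.
split=> [h|[|h]]; [|exact: domDinf_Im|].
  have [i0|] := eqVneq (complex.Im z) 0; [right|by left].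
  by rewrite ltNge; apply/negP => hz; apply: h.
by move=> [_]; rewrite leNgt h.
Qed.

Lemma domDinf_star z t : domDinf z -> 0 <= t <= 1 -> domDinf (2 + t%:C * (z - 2)).
Proof.
move=> /domDinfP zD /andP[t0 t1]; apply/domDinfP.
have hE : (2 : C) = (2 : R)%:C by rewrite rmorph_nat.
have ReE : complex.Re (2 + t%:C * (z - 2)) = 2 + t * (complex.Re z - 2).
  by rewrite hE ReD; case: (z) => x y /=; ring.
have ImE : complex.Im (2 + t%:C * (z - 2)) = t * complex.Im z.
  by rewrite hE ImD; case: (z) => x y /=; ring.
rewrite ReE ImE.
have [->|tn0] := eqVneq t 0; first by right; rewrite mul0r addr0 ltr1n.
case: zD => [i0|h1]; first by left; rewrite mulf_neq0.
right; have : 0 <= t * (complex.Re z - 1) by rewrite mulr_ge0 // subr_ge0 ltW.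
have [->|tn1] := eqVneq t 1; first by rewrite mul1r; lra.
have : 0 < 1 - t by rewrite subr_gt0 lt_neqAle tn1.
by rewrite mulrBr mulr1 mulrBr; lra.
Qed.

Lemma domDinf_inv z : domDinf z -> [/\ z != 0, 1 - z != 0 & domD (1 / z)].
Proof.
move=> /domDinfP zD; rewrite mul1r.
have z0 : z != 0.
  by case: zD; apply: contraTneq => ->; rewrite /= ?eqxx // ltr10.
have z1 : 1 - z != 0.
  rewrite subr_eq0 eq_sym.
  by case: zD; apply: contraTneq => ->; rewrite /= ?eqxx // ltxx.
split=> //; have [i0|i0] := eqVneq (complex.Im z) 0; last exact: domD_Im (Im_inv i0).
case: zD => [|h1]; first by rewrite i0 eqxx.
have zE : z = (complex.Re z)%:C by move: i0; case: (z) => x y /= ->.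
apply/domDP; right; rewrite zE -fmorphV /= invr_gt0 invf_lt1 ?h1 ?andbT //; lra.
Qed.

Lemma G0_ray s (e : R) : cabs s = 1 -> 0 < e -> (forall t, 0 < t < e -> domD (ray s t)) ->
  forall w, (G0 (ray s t) * fexp (- clog (ray s t) *: X)) w @[t --> 0^'+] --> (1 : fps C) w.
Proof.
move=> s1 e0 hD w.
have rW := ray_within e0 hD (ray_cvg0 s1).
exact: (@cvg_comp_complex _ _ 0^'+ _ (ray s)
  (fun z => (G0 z * fexp (- clog z *: X)) w) _ rW (@G0_asymptotic R Li hLi w)).
Qed.

(** The normalization of G_1 restated with the exponent - Y, which is the image of X for both maps
    sending 0 to 1. *)
Lemma G1_ray s (e : R) G1 : is_G1 G1 -> cabs s = 1 -> 0 < e ->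
  (forall t, 0 < t < e -> domD (1 - ray s t)) ->
  forall w, (G1 (1 - ray s t) * fexp (- clog (1 - (1 - ray s t)) *: (- Y))) w @[t --> 0^'+]
    --> (1 : fps C) w.
Proof.
move=> [_ h1] s1 e0 hD w.
have rW := ray_within e0 hD (ray_1m_cvg s1).
have h := @cvg_comp_complex _ _ 0^'+ _ (fun t => 1 - ray s t)
  (fun z => (G1 z * fpow (1 - z) Y) w) _ rW (h1 w).
suff -> : (fun t => (G1 (1 - ray s t) * fexp (- clog (1 - (1 - ray s t)) *: (- Y))) w) =
  (fun t => (G1 (1 - ray s t) * fpow (1 - (1 - ray s t)) Y) w) by exact: h.
by apply/funext => t; rewrite scalerN scaleNr opprK.
Qed.

(** Here - X + Y is the image of X for both maps sending 0 to infinity, and the inverse of the ray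
    is the path to infinity. *)
Lemma Ginf_ray s (e : R) Ginf : is_Ginf Ginf -> cabs s = 1 -> 0 < e ->
  (forall t, 0 < t < e -> domDinf (ray s t)^-1) ->
  forall w, (Ginf (ray s t)^-1 * fexp (- clog (1 / (ray s t)^-1) *: (- X + Y))) w
    @[t --> 0^'+] --> (1 : fps C) w.
Proof.
move=> [_ h1] s1 e0 hD w.
have rW := ray_inv_infty s1 e0 hD.
have h := @cvg_comp_complex _ _ 0^'+ _ (fun t => (ray s t)^-1)
  (fun z => (Ginf z * fpow (1 / z) (X - Y)) w) _ rW (h1 w).
suff -> : (fun t => (Ginf (ray s t)^-1 * fexp (- clog (1 / (ray s t)^-1) *: (- X + Y))) w) =
  (fun t => (Ginf (ray s t)^-1 * fpow (1 / (ray s t)^-1) (X - Y)) w) by exact: h.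
by apply/funext => t; rewrite /fpow scaleNr -scalerN opprD opprK.
Qed.

Lemma lft_op_L1mz G1 z : is_G1 G1 -> domD z -> lft_op L1mz G0 z = G1 z.
Proof.
move=> hG1 zD.
have s1 := cabs1 R; have e1 := @ltr01 R.
have rE t : ray 1 t = t%:C by exact: mulr1.
have hD t : 0 < t < 1 -> domD (1 - ray 1 t).
  move=> /andP[t0 t1]; apply/domDP; right; rewrite rE ReD ReN /=; lra.
(* The path 1 - t is real, and f^{-1} coincides with the local parameter on it; the difference of
   logarithms is therefore 0, and so is c. *)
rewrite (@lft_op_ray R Li hLi L1mz (@domD R) 2^-1 0 1 (fun z => 1 - z)
  (fun t => 1 - ray 1 t) G1 1 s1 e1) //.
- by rewrite scale0r fexp0 mulr1.
- by move=> w t; exact: domD_star.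
- exact: hG1.1.
- move=> w wD; split; [exact: domD_neq0|exact: domD_neq1|apply/domDP].
  move/domDP : wD; rewrite /= ReD ImD ReN ImN /= add0r oppr_eq0 => -[?|/andP[? ?]].
    by left.
  by right; apply/andP; split; lra.
- by move=> t t01; split; [exact: hD|rewrite subKr].
- have -> : (fun t => lft_fun (lft_inv L1mz) (1 - ray 1 t)) = ray (1 : C).
    by apply/funext => t; rewrite /= subKr.
  exact: ray_cvg0.
- by apply: cvg_cst_cabs; apply: (near_right0 e1) => t _; rewrite /= subKr subrr.
- exact: G1_ray hG1 s1 e1 hD.
Qed.

Lemma lft_op_Linvz Ginf z : is_Ginf Ginf -> domDinf z -> lft_op Linvz G0 z = Ginf z.
Proof.
move=> hG zD.
have s1 := cabs1 R; have e1 := @ltr01 R.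
have rE t : ray 1 t = t%:C by exact: mulr1.
have hD t : 0 < t < 1 -> domDinf (ray 1 t)^-1.
  move=> /andP[t0 t1]; apply/domDinfP; right; rewrite rE -fmorphV /= invf_gt1 //.
rewrite (@lft_op_ray R Li hLi Linvz (@domDinf R) 2 0 1 (fun z => 1 / z)
  (fun t => (ray 1 t)^-1) Ginf 1 s1 e1) //.
- by rewrite scale0r fexp0 mulr1.
- by move=> w t; exact: domDinf_star.
- exact: hG.1.
- by move=> w; exact: domDinf_inv.
- by move=> t t01; split; [exact: hD|rewrite mul1r invrK].
- have -> : (fun t => lft_fun (lft_inv Linvz) (ray 1 t)^-1) = ray (1 : C).
    by apply/funext => t; rewrite /= mul1r invrK.
  exact: ray_cvg0.
- by apply: cvg_cst_cabs; apply: (near_right0 e1) => t _; rewrite /= mul1r invrK subrr.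
- exact: Ginf_ray hG s1 e1 hD.
Qed.

Section HalfPlanes.
Variables (s sigma : R).
Hypotheses (hs : s = 1 \/ s = -1) (hsigma : sigma = 1 \/ sigma = -1).
Local Notation r := (ray (0 +i* sigma)).

(** [s] is the sign of Im z and [sigma] that of the local parameter. They agree for the parameter z
    and are opposite for 1 - z and 1/z, which exchange the half planes. *)
Lemma lft_op_half_plane f (a : C -> C) (p : R -> C) G :
  KZ_solution (half_plane s) G ->
  (forall t, 0 < t < 1 -> [/\ half_plane s (p t), a (p t) = r t &
     lft_fun (lft_inv f) (p t) = r t / (r t - 1)]) ->
  (forall w, (G (p t) * fexp (- clog (a (p t)) *: lft_X C f)) w @[t --> 0^'+]
     --> (1 : fps C) w) ->
  forall z, half_plane s z ->
    lft_op f G0 z = G z * fexp ((0 +i* (- sigma * pi)) *: lft_X C f).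
Proof.
move=> hG hp cG; have e1 := @ltr01 R.
apply: (@lft_op_ray R Li hLi f (half_plane s) (0 +i* s) (0 +i* (- sigma * pi))
   (0 +i* sigma) a p G 1 (cabs_imag hsigma) e1) => //.
- by move=> w t; exact: half_plane_star.
- move=> w /half_plane_Im i0; split.
  + by apply: contraNneq i0 => ->.
  + by rewrite subr_eq0 eq_sym; apply: contraNneq i0 => ->.
  + exact/domD_Im/Im_neq0_lft.
- by move=> t /hp[].
- apply: cvg_near_eq (ray_mob_cvg0 hsigma).
  by apply: (near_right0 e1) => t /hp[_ _ ->].
- apply: cvg_near_eq (clog_ray_cvg hsigma).
  by apply: (near_right0 e1) => t /hp[_ _ ->].
Qed.

End HalfPlanes.

Section Sign.
Variable s : R.
Hypothesis hs : s = 1 \/ s = -1.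

Lemma sqr_sign : s * s = 1.
Proof. by case: hs => ->; rewrite ?mulr1 // mulrNN mulr1. Qed.

Lemma sign_neq0 : s != 0.
Proof. by case: hs => ->; rewrite ?oppr_eq0 oner_eq0. Qed.

Lemma signN : - s = 1 \/ - s = -1.
Proof. by case: hs => ->; [right|left; rewrite opprK]. Qed.

Lemma lft_op_Lz_zm1 z : half_plane s z ->
  lft_op Lz_zm1 G0 z = G0 z * fexp ((0 +i* (- s * pi)) *: X).
Proof.
move=> zU; have e1 := @ltr01 R.
have ImE t : complex.Im (ray (0 +i* s) t) = t * s by rewrite ray_imag.
have hD t : 0 < t < 1 -> domD (ray (0 +i* s) t).
  by move=> /andP[t0 _]; apply: domD_Im; rewrite ImE mulf_neq0 ?sign_neq0 // gt_eqF.
have UD : half_plane s `<=` @domD R by move=> w /half_plane_Im /domD_Im.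
apply: (@lft_op_half_plane s s hs hs Lz_zm1 id (ray (0 +i* s))) => //.
- exact: KZ_solution_sub UD (G0_KZ hLi).
- move=> t /andP[t0 _]; split=> //.
  by rewrite /half_plane /mkset ImE mulrCA sqr_sign mulr1.
- exact: G0_ray (cabs_imag hs) e1 hD.
Qed.

Lemma lft_op_Linv1mz G1 z : is_G1 G1 -> half_plane s z ->
  lft_op Linv1mz G0 z = G1 z * fexp ((0 +i* (s * pi)) *: (- Y)).
Proof.
move=> hG1 zU; have e1 := @ltr01 R.
have ImE t : complex.Im (1 - ray (0 +i* (- s)) t) = t * s.
  by rewrite ray_imag ImD ImN /= add0r mulrN opprK.
have hU t : 0 < t < 1 -> half_plane s (1 - ray (0 +i* (- s)) t).
  by move=> /andP[t0 _]; rewrite /half_plane /mkset ImE mulrCA sqr_sign mulr1.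
have UD : half_plane s `<=` @domD R by move=> w /half_plane_Im /domD_Im.
have hD t : 0 < t < 1 -> domD (1 - ray (0 +i* (- s)) t) by move=> /hU /UD.
(* The sign is presented as - sigma with sigma = - s, the side on which 1 - z approaches 0. *)
rewrite -[s in X in fexp X]opprK.
apply: (@lft_op_half_plane s (- s) hs signN Linv1mz (fun z => 1 - z)
  (fun t => 1 - ray (0 +i* (- s)) t)) => //.
- exact: KZ_solution_sub UD hG1.1.
- move=> t t01; split; [exact: hU|by rewrite subKr|].
  rewrite /= addrAC subrr add0r -[ray _ _ - 1]opprB.
  by rewrite invrN mulrN mulNr.
- exact: G1_ray hG1 (cabs_imag signN) e1 hD.
Qed.

Lemma lft_op_Lzm1_z Ginf z : is_Ginf Ginf -> half_plane s z ->
  lft_op Lzm1_z G0 z = Ginf z * fexp ((0 +i* (s * pi)) *: (- X + Y)).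
Proof.
move=> hG zU; have e1 := @ltr01 R.
have rn0 t : 0 < t -> ray (0 +i* (- s)) t != 0.
  by move=> t0; apply: ray_neq0 t0; exact: (cabs_imag signN).
have hU t : 0 < t < 1 -> half_plane s (ray (0 +i* (- s)) t)^-1.
  move=> /andP[t0 _]; rewrite /half_plane /mkset.
  have -> : complex.Im (ray (0 +i* (- s)) t)^-1 = t * s / (t * s) ^+ 2.
    by rewrite ray_imag /= expr0n add0r mulrN mulNr opprK sqrrN.
  rewrite mulrA mulrCA sqr_sign mulr1 divr_gt0 // exprn_even_gt0 //=.
  by rewrite mulf_neq0 ?sign_neq0 // gt_eqF.
have UD : half_plane s `<=` @domDinf R by move=> w /half_plane_Im /domDinf_Im.
have hD t : 0 < t < 1 -> domDinf (ray (0 +i* (- s)) t)^-1 by move=> /hU /UD.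
(* Again sigma = - s, because 1/z lies in the half plane opposite to that of z. *)
rewrite -[s in X in fexp X]opprK.
apply: (@lft_op_half_plane s (- s) hs signN Lzm1_z (fun z => 1 / z)
  (fun t => (ray (0 +i* (- s)) t)^-1)) => //.
- exact: KZ_solution_sub UD hG.1.
- move=> t t01; split; [exact: hU|by rewrite mul1r invrK|].
  have t0 : 0 < t by case/andP: t01.
  have := rn0 t t0; have := hU t t01 => /half_plane_Im i0 n0.
  have n1 : ray (0 +i* (- s)) t - 1 != 0.
    rewrite subr_eq0; apply/eqP => e; move: i0; rewrite e invr1 /=.
    by rewrite eqxx.
  by rewrite /=; field; rewrite n0 n1.
- exact: Ginf_ray hG (cabs_imag signN) e1 hD.
Qed.

End Sign.
End ConnectionFormulas.

Theorem proposition2 (R : realType) (Li : word -> R[i] -> R[i])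
    (G1 Ginf : R[i] -> fps R[i]) (hLi : polylogarithms Li)
    (hG1 : is_G1 G1) (hGinf : is_Ginf Ginf) :
  let G0 := G0_series Li in
  let X := fX R[i] in let Y := fY R[i] in let ipi : R[i] := 0 +i* pi in
  [/\ forall z : R[i], domD z -> lft_op L1mz G0 z = G1 z,
      forall z : R[i], domDinf z -> lft_op Linvz G0 z = Ginf z,
      forall z : R[i],
        (0 < complex.Im z -> lft_op Lz_zm1 G0 z = G0 z * fexp (- (ipi *: X))) /\
        (complex.Im z < 0 -> lft_op Lz_zm1 G0 z = G0 z * fexp (ipi *: X)),
      forall z : R[i],
        (0 < complex.Im z -> lft_op Linv1mz G0 z = G1 z * fexp (- (ipi *: Y))) /\
        (complex.Im z < 0 -> lft_op Linv1mz G0 z = G1 z * fexp (ipi *: Y))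
    & forall z : R[i],
        (0 < complex.Im z -> lft_op Lzm1_z G0 z = Ginf z * fexp (ipi *: (- X + Y))) /\
        (complex.Im z < 0 -> lft_op Lzm1_z G0 z = Ginf z * fexp (- (ipi *: (- X + Y))))].
Proof.
move=> G0 X Y ipi.
have hs1 : (1 : R) = 1 \/ (1 : R) = -1 by left.
have hsN1 : (-1 : R) = 1 \/ (-1 : R) = -1 by right.
have U1 z : 0 < complex.Im z -> half_plane 1 z by rewrite /half_plane /= mul1r.
have UN1 z : complex.Im z < 0 -> half_plane (-1) z by rewrite /half_plane /= mulN1r oppr_gt0.
have ipiE : 0 +i* (1 * pi) = ipi by rewrite mul1r.
have ipiEN : 0 +i* (-1 * pi) = - ipi.
  by rewrite /ipi mulN1r; apply/eqP; rewrite eq_complex /= oppr0 !eqxx.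
split.
- by move=> z; exact: lft_op_L1mz.
- by move=> z; exact: lft_op_Linvz.
- move=> z; split=> [/U1 zU|/UN1 zU].
    by rewrite (lft_op_Lz_zm1 hLi hs1 zU) ipiEN scaleNr.
  by rewrite (lft_op_Lz_zm1 hLi hsN1 zU) opprK ipiE.
- move=> z; split=> [/U1 zU|/UN1 zU].
    by rewrite (lft_op_Linv1mz hLi hs1 hG1 zU) ipiE scalerN.
  by rewrite (lft_op_Linv1mz hLi hsN1 hG1 zU) ipiEN scaleNr scalerN opprK.
- move=> z; split=> [/U1 zU|/UN1 zU].
    by rewrite (lft_op_Lzm1_z hLi hs1 hGinf zU) ipiE.
  by rewrite (lft_op_Lzm1_z hLi hsN1 hGinf zU) ipiEN scaleNr.
Qed.
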